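(* Let $d=1$ and $q\geq 3$, or let $d\geq 2$ and $q\geq 4$ ($d,q$ integers). There exist positive constants $c$ and $C$ depending only on $q$ and $d$ such that the following hold. (i) There exists an ffiid $q$-coloring of $\mathbb{Z}^d$ whose coding radius $R$ satisfies $$\mathbb{P}(R>r)\leq \frac{1}{\operatorname{tower}(cr)}\qquad\text{for all real } r\geq 0.$$ (ii) Every ffiid $q$-coloring of $\mathbb{Z}^d$ has coding radius $R$ satisfying $$\mathbb{P}(R>r)\geq \frac{1}{\operatorname{tower}(Cr)}\qquad\text{for all real } r\geq 0.$$
   Context: Write $|\cdot|$ for the $1$-norm on $\mathbb{Z}^d$ and $B(r)=\{v\in\mathbb{Z}^d:|v|\leq r\}$. A $q$-coloring of $\mathbb{Z}^d$ is a random element $X=(X_v)_{v\in\mathbb{Z}^d}$ of $\{1,\dots,q\}^{\mathbb{Z}^d}$ such that almost surely $X_u\neq X_v$ whenever $|u-v|=1$. A process $X$ on $\mathbb{Z}^d$ is ffiid (a finitary factor of an iid process) if $X=F(Y)$ for some family $Y=(Y_v)_{v\in\mathbb{Z}^d}$ of iid random variables (with values in an arbitrary measurable space) and some measurable map $F$ that commutes with every translation of $\mathbb{Z}^d$, such that for almost every $y$ (with respect to the law of $Y$) there exists $r<\infty$ such that whenever $y'$ agrees with $y$ on $B(r)$ we have $F(y')_0=F(y)_0$. The minimum such non-negative integer $r$ is denoted $R(y)$, and $R=R(Y)$ is the coding radius of the factor. For a non-negative integer $r$, $\operatorname{tower}(r)=\exp\cdots\exp 1$ with $\exp$ iterated $r$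 times (so $\operatorname{tower}(0)=1$); for real $r\geq 0$, $\operatorname{tower}(r)=\operatorname{tower}(\lfloor r\rfloor)$. *)

(* Defs.v *)
From HB Require Import structures.
From mathcomp Require Import all_boot all_order all_algebra finmap.
From mathcomp Require Import all_classical all_reals all_analysis.

Set Implicit Arguments.
Unset Strict Implicit.
Unset Printing Implicit Defensive.

Import Order.TTheory GRing.Theory Num.Theory.

Local Open Scope classical_set_scope.
Local Open Scope ring_scope.

Notation Zd d := 'rV[int]_d.

Definition norm1 (d : nat) (v : Zd d) : nat := (\sum_(i < d) `|v ord0 i|)%N.

Definition config (d : nat) (A : Type) := Zd d -> A.

Definition translate (d : nat) (A : Type) (u : Zd d) (x : config d A) :
  config d A := fun v => x (v + u).

Definition agree_on_ball (d : nat) (A : Type) (n : nat) (y y' : config d A) :=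
  forall v : Zd d, (norm1 v <= n)%N -> y' v = y v.

(* [<<s cylinders d G >>] is the product sigma-algebra on [Zd d -> A] when [G]
   is the sigma-algebra of [A]. *)
Definition cylinders (d : nat) (A : Type) (G : set (set A)) :
    set (set (config d A)) :=
  \bigcup_(v in [set: Zd d]) preimage_set_system setT (fun x => x v) G.
Arguments cylinders d {A} G.

Definition labelings (d : nat) (dS : measure_display) (S : measurableType dS) :=
  g_sigma_algebraType (cylinders d (@measurable dS S)).

(* 'I_q stands for {1, ..., q}; it carries the discrete sigma-algebra. It is
   not a [measurableType], for want of a point when q = 0, so measurability
   with respect to the product sigma-algebra is written out. *)
Definition measurable_coloring (d q : nat) (dT : measure_display)
    (T : measurableType dT) (X : T -> config d 'I_q) :=
  forall B : set (config d 'I_q),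
    <<s cylinders d (@discrete_measurable 'I_q) >> B -> measurable (X @^-1` B).

Definition coloring_process (R : realType) (d q : nat) (dO : measure_display)
    (Omega : measurableType dO) (P : probability Omega R)
    (X : Omega -> config d 'I_q) : Prop :=
  measurable_coloring X /\
  {ae P, forall w, forall u v : Zd d, norm1 (u - v) = 1%N -> X w u <> X w v}.

Section finitary_factor.
Context (R : realType) (d q : nat) (dO : measure_display)
  (Omega : measurableType dO) (P : probability Omega R)
  (dS : measure_display) (S : measurableType dS).
Implicit Types (Y : {RV P >-> labelings d S}).
Implicit Types (F : labelings d S -> config d 'I_q).

Definition independent_family Y : Prop :=
  forall (V : {fset Zd d}) (B : Zd d -> set S), (forall v, measurable (B v)) ->
    (P [set w | forall v, v \in V -> B v (Y w v)] =
     \prod_(v <- V) P [set w | B v (Y w v)])%E.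

Definition identically_distributed Y : Prop :=
  forall (u v : Zd d) (B : set S), measurable B ->
    P [set w | B (Y w u)] = P [set w | B (Y w v)].

Definition iid_family Y : Prop :=
  independent_family Y /\ identically_distributed Y.

Definition equivariant F : Prop :=
  forall (u : Zd d) (y : labelings d S), F (translate u y) = translate u (F y).

Definition determined F (y : labelings d S) (n : nat) : Prop :=
  forall y' : labelings d S, agree_on_ball n y y' -> F y' 0 = F y 0.

(* The infimum is a minimum, unless no radius determines the color at the
   origin, in which case it is +oo. *)
Definition coding_radius F (y : labelings d S) : \bar R :=
  ereal_inf [set n%:R%:E | n in [set n : nat | determined F y n]].

Definition ffiid (X : Omega -> config d 'I_q) Y F : Prop :=
  [/\ iid_family Y,
      measurable_coloring F,
      equivariant F,
      {ae distribution P Y, forall y, exists n, determined F y n} &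
      forall w, X w = F (Y w)].

(* P(R > r). As the coding radius involves a quantification over all
   labelings, {R > r} need not be measurable for an arbitrary label space, so
   the outer measure [P^*] is used; it agrees with [P], and with the completion
   of [P], wherever these are defined. *)
Definition coding_radius_tail Y F (r : R) : \bar R :=
  (P^*)%mu [set w | (r%:E < coding_radius F (Y w))%E].

End finitary_factor.
Arguments independent_family {R d dO Omega} P {dS S} Y.
Arguments identically_distributed {R d dO Omega} P {dS S} Y.
Arguments iid_family {R d dO Omega} P {dS S} Y.
Arguments coding_radius R {d q dS S} F y.
Arguments ffiid {R d q dO Omega} P {dS S} X Y F.
Arguments coding_radius_tail {R d q dO Omega} P {dS S} Y F r.

(* [Num.truncn r] is the floor of r for r >= 0. *)
Definition tower (R : realType) (r : R) : R := iter (Num.truncn r) (@expR R) 1.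

(* Main.v *)
Require Import Defs.
From HB Require Import structures.
From mathcomp Require Import all_boot all_order all_algebra finmap.
From mathcomp Require Import all_classical all_reals all_analysis.
From mathcomp Require Import measurable_realfun zify ring lra.

(** The coloring of part (i) combines two ingredients.

    The first is fast color reduction along a line.  Replace the label of each
    site by the position of the first bit where it differs from the next label,
    together with its own bit there: consecutive labels stay distinct, and labels
    below 2^m become labels below 2m.  Started from independent uniform bit
    sequences, n rounds bring the labels of a site below 6, unless one of n + 1
    first differing positions nearby is at least [threshold n]; the thresholds
    grow like a tower, and this event has probability of order 2^-(threshold n)
    ([reduced_lt6], [agree_prob], [threshold_tail]).  A site has its turn when its
    labels in all relevant directions are small, the labels themselves breaking
    ties, so that nearby sites have different turns.  A greedy rule run in the
    order of the turns decides almost every site, and a site decided after n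
    rounds depends on labels at distance linear in n ([assigned_by],
    [assigned_local], [greedy_assigned]).

    The second is a greedy rule whose outcome is turned into a proper coloring by
    a map of finite range ([local_rule_exists]).  On the line, avoiding the colors
    of two neighbors takes three colors.  In higher dimension, the greedy rule
    selects anchors that are separated and within bounded distance of every site,
    with a box around each anchor such that nearby walls in a common direction are
    at distance at least 2.  A site takes the parity of its distance to the center
    of the smallest box that contains it.  Adjacent sites of equal parity are
    separated by a wall; since walls keep apart, a connected set of sites of equal
    parity fits in a unit cube ([component_cube]).  Each such component is finite
    and bipartite, so a second parity completes a coloring with four colors.

    For part (ii), write v_0 for one coordinate of a site v.  Call a color forced
    when resampling all labels outside the slabs |v_0| <= n almost surely leaves
    that color at the origin.  If no color is forced then R > n.  The forced color
    depends on 2n + 1 slabs and, the coloring being proper, it agrees with its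
    translate by one step with probability at most twice that of no color being
    forced ([unforced_lower_bound]).  Conversely such agreements cannot be rare.
    From a function with q values depending on m + 1 slabs, form the set of values
    that it takes with probability more than eps given the first m slabs.  If this
    set agrees with its translate, then the function agrees with its own with
    probability almost eps, so lower bounds on agreement are squared, up to a
    constant, when passing from 2^q values and m slabs to q values and m + 1 slabs
    ([agreement_ge], [likely_agreement_bound]).  After all slabs are eliminated the
    function is constant and agreement is certain; reading the steps backwards
    gives a tower bound ([agreement_lower_bound]).  For r < 1 the bound asks that
    R > 0 almost surely: if the label slab of the origin forced a color with
    positive probability then, by independence, two adjacent sites would be forced
    to the same color with positive probability ([unforced_prob1]).  All these
    computations rest on one fact: replacing the labels on any set of sites by
    those of an independent copy does not change the law ([law_resample]). *)

Set Implicit Arguments.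
Unset Strict Implicit.
Unset Printing Implicit Defensive.
Import Order.TTheory GRing.Theory Num.Theory.
Local Open Scope classical_set_scope.
Local Open Scope ring_scope.

(** * Product sigma-algebra of labelings *)

Section labelings_measurability.
Context (d : nat) (dS : measure_display) (S : measurableType dS).

Lemma measurable_label (v : Zd d) :
  measurable_fun setT (fun y : labelings d S => y v).
Proof.
move=> _ B mB; rewrite setTI; apply: sub_sigma_algebra.
by exists v => //; exists B => //; rewrite setTI.
Qed.

Lemma measurable_to_labelings dT (T : measurableType dT) (g : T -> labelings d S) :
  (forall v, measurable_fun setT (fun t => g t v)) -> measurable_fun setT g.
Proof.
move=> mg; apply: (@measurability _ _ T (labelings d S) setT g (cylinders d (@measurable dS S))) => //.
move=> _ [_ [v _ [B mB <-]] <-]; rewrite !setTI.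
by have := mg v measurableT B mB; rewrite setTI.
Qed.

Lemma measurable_translate (u : Zd d) :
  measurable_fun setT (translate u : labelings d S -> labelings d S).
Proof. by apply: measurable_to_labelings => v; exact: measurable_label. Qed.

Definition mix (A : pred (Zd d)) (y y' : labelings d S) : labelings d S :=
  fun v => if A v then y v else y' v.

Lemma measurable_mix A :
  measurable_fun setT (fun z : labelings d S * labelings d S => mix A z.1 z.2).
Proof.
apply: measurable_to_labelings => v; rewrite /mix; case: (A v).
- exact: (measurableT_comp (measurable_label v) measurable_fst).
- exact: (measurableT_comp (measurable_label v) measurable_snd).
Qed.

Definition rectangle (V : {fset Zd d}) (B : Zd d -> set S) : set (labelings d S) :=
  [set y | forall v, v \in V -> B v (y v)].

(** A pi-system that generates the sigma-algebra, on which the law of an iid labeling is a product; measures are compared on it. *)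
Definition rectangles : set (set (labelings d S)) :=
  [set C | exists V B, (forall v, measurable (B v)) /\ C = rectangle V B].

Lemma measurable_rectangle V B : (forall v, measurable (B v)) ->
  measurable (rectangle V B).
Proof.
move=> mB.
have -> : rectangle V B = \bigcap_(v in [set` V]) ((fun y : labelings d S => y v) @^-1` B v).
  by apply/seteqP; split => y /= h v; apply: h.
apply: fin_bigcap_measurable => [|v _]; first exact: finite_fset.
by rewrite -[X in measurable X]setTI; apply: measurable_label.
Qed.

Lemma rectangles_setI : setI_closed rectangles.
Proof.
move=> _ _ [V [B [mB ->]]] [V' [B' [mB' ->]]].
exists (V `|` V')%fset,
  (fun v => (if v \in V then B v else setT) `&` (if v \in V' then B' v else setT)).
split.
  by move=> v; apply: measurableI; case: ifP.
apply/seteqP; split => y /=.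
  by move=> [h h'] v _; split; case: ifPn => // vV; [apply: h|apply: h'].
move=> h; split=> v vV.
  by have := h v; rewrite in_fsetU vV => /(_ isT) [].
by have := h v; rewrite in_fsetU vV orbT => /(_ isT) [].
Qed.

(** Rectangles with a single constrained site are the generators of the product sigma-algebra. *)
Lemma measurable_labelingsE :
  (@measurable _ (labelings d S)) = <<s rectangles >>.
Proof.
apply/seteqP; split.
  apply: smallest_sub; first exact: smallest_sigma_algebra.
  move=> _ [v _ [B mB <-]]; rewrite setTI.
  apply: sub_sigma_algebra; exists [fset v]%fset, (fun=> B); split => //.
  apply/seteqP; split => y /=; first by move=> By u; rewrite inE => /eqP ->.
  by apply; rewrite inE.
apply: smallest_sub; first exact: sigma_algebra_measurable.
by move=> _ [V [B [mB ->]]]; exact: measurable_rectangle.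
Qed.

Lemma eq_measure_labelings (R : realType)
    (m1 m2 : {measure set (labelings d S) -> \bar R}) :
  (m1 setT < +oo)%E ->
  (forall V B, (forall v, measurable (B v)) ->
    m1 (rectangle V B) = m2 (rectangle V B)) ->
  forall C, measurable C -> m1 C = m2 C.
Proof.
move=> m1T m12 C mC.
apply: (measure_unique rectangles (fun=> setT)) => //.
- exact: measurable_labelingsE.
- exact: rectangles_setI.
- move=> _; exists fset0, (fun=> setT); split => //.
  by apply/seteqP; split.
- by rewrite bigcup_const.
- by move=> _ [V [B [mB ->]]]; apply: m12.
Qed.

End labelings_measurability.

(** * Stationarity and resampling of iid labelings *)

Section iid_law.
Context (R : realType) (d : nat) (dS : measure_display) (S : measurableType dS).

(** Law-preserving maps are recognized on rectangles; [g] may have any domain, so that it applies to translations and to mixtures of two labelings alike. *)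
Lemma pushforward_labelings dT (T : measurableType dT)
    (m1 : {measure set T -> \bar R}) (m : {measure set (labelings d S) -> \bar R})
    (g : T -> labelings d S) :
  measurable_fun setT g -> (m1 setT < +oo)%E ->
  (forall V B, (forall v, measurable (B v)) ->
    m1 (g @^-1` rectangle V B) = m (rectangle V B)) ->
  forall C, measurable C -> m1 (g @^-1` C) = m C.
Proof.
move=> mg m1T eqm C mC.
pose m2 : {measure set (labelings d S) -> \bar R} :=
  measure_function_pushforward__canonical__measure_function_Measure m1 mg.
exact: (@eq_measure_labelings d dS S R m2 m).
Qed.

Context (dO : measure_display)
  (Omega : measurableType dO) (P : probability Omega R).
Variable Y : {RV P >-> labelings d S}.
Hypothesis iidY : iid_family P Y.
Let mu := distribution P Y.

Lemma law_setT : mu setT = 1%E.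
Proof. exact: (@probability_setT _ _ _ (distribution P Y)). Qed.

Lemma law_rectangle V B : (forall v, measurable (B v)) ->
  mu (rectangle V B) =
  (\prod_(v <- V) mu [set y : labelings d S | B v (y 0%R)])%E.
Proof.
move=> mB; have [indY idY] := iidY.
rewrite /mu /distribution /pushforward.
have -> : Y @^-1` rectangle V B = [set w | forall v, v \in V -> B v (Y w v)] by [].
rewrite indY//; apply: eq_bigr => v _.
by rewrite (idY v 0%R).
Qed.

Lemma law_translate (u : Zd d) (C : set (labelings d S)) : measurable C ->
  mu (translate u @^-1` C) = mu C.
Proof.
move=> mC; apply: pushforward_labelings => //.
- exact: measurable_translate.
- by rewrite [X in (X < _)%E]law_setT ltry.
move=> V B mB.
have -> : translate u @^-1` rectangle V B =
    rectangle [fset (v + u)%R | v in V]%fset (fun v => B (v - u)).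
  apply/seteqP; split => y /= h v.
    move=> /imfsetP[w /= wV ->]; rewrite addrK; exact: h.
  move=> vV; have := h (v + u); rewrite addrK; apply.
  by apply/imfsetP; exists v.
rewrite [LHS]law_rectangle// [RHS]law_rectangle// big_imfset/=; last by move=> x y _ _ /addIr.
by apply: eq_bigr => v _; rewrite addrK.
Qed.

(** The preimage of a rectangle is the product of its constraints inside and outside [A], whose probabilities multiply to that of the rectangle by independence. *)
Lemma law_mix (A : pred (Zd d)) (C : set (labelings d S)) : measurable C ->
  (mu \x mu)%E ((fun z => mix A z.1 z.2) @^-1` C) = mu C.
Proof.
move=> mC; apply: (pushforward_labelings (m1 := (mu \x mu)%E)) => //.
- exact: measurable_mix.
- by rewrite -setXTT [X in (X < _)%E]product_measure1E// [X in (X * _)%E]law_setT [X in (_ * X)%E]law_setT mule1 ltry.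
move=> V B mB.
have -> : (fun z => mix A z.1 z.2) @^-1` rectangle V B =
   rectangle V (fun v => if A v then B v else setT) `*`
   rectangle V (fun v => if A v then setT else B v).
  apply/seteqP; split => -[y y'] /=.
    by move=> h; split => v vV; have := h v vV; rewrite /mix; case: (A v).
  by move=> [h h'] v vV; have := h v vV; have := h' v vV; rewrite /mix; case: (A v).
have m1 : forall v, measurable (if A v then B v else setT) by move=> v; case: ifP.
have m2 : forall v, measurable (if A v then setT else B v) by move=> v; case: ifP.
rewrite [LHS]product_measure1E; [|exact: measurable_rectangle..].
rewrite [X in (X * _)%E]law_rectangle// [X in (_ * X)%E]law_rectangle// [RHS]law_rectangle// -big_split/=; apply: eq_bigr => v _.
have muT : mu [set y : labelings d S | setT (y 0)] = 1%E by exact: law_setT.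
by case: (A v); [rewrite [X in (_ * X)%E]muT mule1|rewrite [X in (X * _)%E]muT mul1e].
Qed.

(** Fubini form of [law_mix]: an event may be conditioned on the labels in [A] by drawing the other labels afresh. *)
Lemma law_resample (A : pred (Zd d)) (C : set (labelings d S)) : measurable C ->
  mu C = (\int[mu]_y mu [set y' | C (mix A y y')])%E.
Proof.
move=> mC; rewrite -(law_mix A mC) /product_measure1; apply: eq_integral => y _ /=.
by rewrite /xsection/=; congr (mu _); apply/seteqP; split => y' /=; rewrite inE.
Qed.

Lemma measurable_resample (A : pred (Zd d)) (C : set (labelings d S)) : measurable C ->
  measurable_fun setT (fun y : labelings d S => mu [set y' | C (mix A y y')] : \bar R).
Proof.
move=> mC.
have mC' : measurable ((fun z : labelings d S * labelings d S => mix A z.1 z.2) @^-1` C).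
  by rewrite -[X in measurable X]setTI; apply: measurable_mix.
rewrite [X in measurable_fun _ X](_ : _ = (mu \o xsection
    ((fun z : labelings d S * labelings d S => mix A z.1 z.2) @^-1` C))).
  exact: measurable_fun_xsection.
apply/funext => y /=.
by rewrite /xsection/=; congr (mu _); apply/seteqP; split => y' /=; rewrite inE.
Qed.

Lemma measurable_mix_section (A : pred (Zd d)) (y : labelings d S) (C : set (labelings d S)) : measurable C ->
  measurable [set y' | C (mix A y y')].
Proof.
move=> mC; suff mA : measurable_fun setT (mix A y).
  by rewrite -[X in measurable X]setTI; exact: mA.
apply: measurable_to_labelings => v; rewrite /mix; case: (A v).
  exact: measurable_cst.
exact: measurable_label.
Qed.

End iid_law.

(** * Eliminating a slab at the cost of a larger palette *)

Section finite_valued.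
Context (dT : measure_display) (T : measurableType dT).

(** Measurability for the discrete sigma-algebra, stated through fibers because the finite type may be empty. *)
Definition simple_measurable (C : finType) (f : T -> C) :=
  forall c, measurable (f @^-1` [set c]).

Lemma measurable_rel (C1 C2 : finType) (f1 : T -> C1) (f2 : T -> C2)
    (Q : C1 -> C2 -> Prop) :
  simple_measurable f1 -> simple_measurable f2 ->
  measurable [set y | Q (f1 y) (f2 y)].
Proof.
move=> m1 m2.
have -> : [set y | Q (f1 y) (f2 y)] =
   \bigcup_(c in [set c : C1 * C2 | Q c.1 c.2])
     (f1 @^-1` [set c.1] `&` f2 @^-1` [set c.2]).
  apply/seteqP; split => y /=; first by move=> h; exists (f1 y, f2 y).
  by move=> [[c1 c2] /= h [-> ->]].
apply: fin_bigcup_measurable; first exact: finite_finset.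
by move=> c _; apply: measurableI.
Qed.

Lemma simple_measurable_set (C : finType) (A : T -> {set C}) :
  (forall c, measurable [set y | c \in A y]) -> simple_measurable A.
Proof.
move=> mA B.
have -> : A @^-1` [set B] = \bigcap_(c in setT)
    (if c \in B then [set y | c \in A y] else ~` [set y | c \in A y]).
  apply/seteqP; split => y /=; first by move=> <- c _; case: ifPn => // /negP.
  move=> hy; apply/setP => c; have := hy c I.
  by case: ifPn => // cA /negP/negbTE.
apply: fin_bigcap_measurable; first exact: finite_finset.
by move=> c _; case: ifP => // _; exact: measurableC.
Qed.

Lemma simple_measurable_post (C1 C2 : finType) (g : C1 -> C2) (f : T -> C1) :
  simple_measurable f -> simple_measurable (g \o f).
Proof. by move=> mf c; exact: (measurable_rel (fun a _ => g a = c) mf mf). Qed.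

End finite_valued.

Lemma simple_measurable_comp dT (T : measurableType dT) dT' (T' : measurableType dT')
    (g : T' -> T) (C : finType) (f : T -> C) :
  measurable_fun setT g -> simple_measurable f -> simple_measurable (f \o g).
Proof.
by move=> mg mf c; rewrite comp_preimage -[X in measurable X]setTI; apply: mg.
Qed.

Lemma union_bound (R : realType) dT (T : measurableType dT)
    (m : {measure set T -> \bar R}) (I : eqType) (s : seq I) (A : I -> set T) (eps : R) :
  (forall i, measurable (A i)) -> (forall i, i \in s -> (m (A i) <= eps%:E)%E) ->
  measurable [set y | exists2 i, i \in s & A i y] /\
  (m [set y | exists2 i, i \in s & A i y] <= ((size s)%:R * eps)%:E)%E.
Proof.
move=> mA; elim: s => [_|i s IHs mAe].
  have -> : [set y | exists2 i, i \in [::] & A i y] = set0.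
    by apply/seteqP; split => y // -[].
  by rewrite measure0 mul0r; split.
have [|m1 m2] := IHs; first by move=> j js; apply: mAe; rewrite inE js orbT.
have -> : [set y | exists2 j, j \in i :: s & A j y] =
   A i `|` [set y | exists2 j, j \in s & A j y].
  apply/seteqP; split => y /=.
    by move=> [j]; rewrite inE => /orP[/eqP ->|js] Ay; [left|right; exists j].
  by move=> [Ay|[j js Ay]]; [exists i|exists j] => //; rewrite inE ?eqxx ?js ?orbT.
split; first exact: measurableU.
apply: (le_trans (measureU2 _ _ _)) => //=.
rewrite -[(size s).+1]add1n natrD mulrDl mul1r EFinD; apply: leeD => //.
by apply: mAe; rewrite inE eqxx.
Qed.

Section resampling_bounds.
Context (R : realType) (d : nat) (dS : measure_display) (S : measurableType dS)
  (dO : measure_display) (Omega : measurableType dO) (P : probability Omega R).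
Variable Y : {RV P >-> labelings d S}.
Hypothesis iidY : iid_family P Y.
Local Notation mu := (distribution P Y).
Local Notation M := (labelings d S).

Lemma resample_ge (A : pred (Zd d)) (B D : set M) (eps : R) : 0 <= eps ->
  measurable B -> measurable D ->
  (forall y, B y -> (eps%:E <= mu [set y' | D (mix A y y')])%E) ->
  (eps%:E * mu B <= mu D)%E.
Proof.
move=> e0 mB mD h; rewrite (law_resample iidY A mD).
apply: (@le_trans _ _ (\int[mu]_(y in B) mu [set y' | D (mix A y y')])%E).
  rewrite -integral_cst//; apply: ge0_le_integral => //.
  by apply: measurable_funTS; exact: measurable_resample.
apply: ge0_subset_integral => //.
exact: measurable_resample.
Qed.

Lemma resample_le (A : pred (Zd d)) (D : set M) (eps : R) :
  measurable D -> (forall y, (mu [set y' | D (mix A y y')] <= eps%:E)%E) ->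
  (mu D <= eps%:E)%E.
Proof.
move=> mD h; rewrite (law_resample iidY A mD).
apply: (@le_trans _ _ (\int[mu]_(y in setT) eps%:E)%E).
  have e0 : 0 <= eps by rewrite -lee_fin; apply: le_trans (h point).
  apply: ge0_le_integral => //; exact: measurable_resample.
by rewrite integral_cst// [X in (_ * X)%E]law_setT mule1.
Qed.

End resampling_bounds.

Section color_elimination.
Context (R : realType) (d : nat) (dS : measure_display) (S : measurableType dS)
  (dO : measure_display) (Omega : measurableType dO) (P : probability Omega R).
Variable Y : {RV P >-> labelings d S}.
Hypothesis iidY : iid_family P Y.
Variable i0 : 'I_d.
Local Notation mu := (distribution P Y).
Local Notation M := (labelings d S).

(** The sites whose labels are kept when the slabs from [b] on are resampled. *)
Definition below (b : int) : pred (Zd d) := fun v => v ord0 i0 < b.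

(** [f] depends only on the labels in [m] consecutive slabs, the first of which is at height [a]. *)
Definition slab_function (a : int) (m : nat) (C : Type) (f : M -> C) :=
  forall y y' : M, (forall v : Zd d, a <= v ord0 i0 < a + m%:Z -> y v = y' v) ->
  f y = f y'.

Definition shift_up : M -> M := translate (delta_mx ord0 i0).

Lemma measurable_shift_up : measurable_fun setT shift_up.
Proof. exact: measurable_translate. Qed.

Lemma shift_up_mix (b : int) (y y' : M) :
  shift_up (mix (below (b + 1)) y y') = mix (below b) (shift_up y) (shift_up y').
Proof.
apply/funext => v; rewrite /shift_up /translate /mix /below !mxE !eqxx/=.
by rewrite ltrD2r.
Qed.

Section one_step.
Variables (C : finType) (a : int) (m : nat) (f : M -> C) (eps : R).
Hypothesis e0 : 0 < eps.
Hypothesis mf : simple_measurable f.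
Hypothesis slabf : slab_function a m.+1 f.

Let b := a + m%:Z.
Let h (c : C) (y : M) : \bar R := mu [set y' | f (mix (below b) y y') = c].

(** The values of [f] that keep probability more than [eps] once the last slab is resampled: a function of one slab less with an exponentially larger palette. *)
Definition likely_values (y : M) : {set C} := [set c | `[< (eps%:E < h c y)%E >]].

Lemma likely_values_slab : slab_function a m likely_values.
Proof.
move=> y y' yy'; apply/setP => c; rewrite !inE; congr (`[< (_ < _)%E >]).
congr (mu _); apply/funext => z /=; congr (_ = c).
apply: slabf => v /andP[av vm]; rewrite /mix /below; case: ifPn => // vb.
by apply: yy'; rewrite av.
Qed.

Lemma likely_values_measurable : simple_measurable likely_values.
Proof.
apply: simple_measurable_set => c.
have -> : [set y | c \in likely_values y] = [set y | (eps%:E < h c y)%E].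
  by apply/seteqP; split => y /=; rewrite inE => /asboolP.
have -> : [set y | (eps%:E < h c y)%E] = h c @^-1` [set x | (eps%:E < x)%E] by [].
rewrite -[X in measurable X]setTI; apply: (@measurable_resample _ _ _ _ _ _ _ Y (below b) (f @^-1` [set c])) => //.
have -> : [set x : \bar R | (eps%:E < x)%E] = `]eps%:E, +oo[%classic.
  by apply/seteqP; split => x /=; rewrite in_itv/= ?andbT.
exact: emeasurable_itv.
Qed.

(** Resample the slab that [f] after the shift sees and [f] does not. If the value of [f] is a likely value one step further, the resampled slab produces it with probability more than [eps]. *)
Lemma agreement_ge :
  (eps%:E * mu [set y | f y \in likely_values (shift_up y)]
    <= mu [set y | f y = f (shift_up y)])%E.
Proof.
apply: (resample_ge iidY (A := below (b + 1))); first exact: ltW.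
- apply: (measurable_rel (fun c (A : {set C}) => c \in A) mf).
  apply: simple_measurable_comp; first exact: measurable_shift_up.
  exact: likely_values_measurable.
- apply: (measurable_rel (fun c c' : C => c = c') mf).
  apply: simple_measurable_comp => //; exact: measurable_shift_up.
move=> y /=; rewrite inE => /asboolP /ltW /le_trans; apply.
rewrite /h -(law_translate iidY (delta_mx ord0 i0)); last first.
  exact: (@measurable_mix_section _ _ _ (below b) (shift_up y) (f @^-1` [set f y])).
rewrite le_eqVlt; apply/orP; left; apply/eqP; congr (mu _).
apply/seteqP; split => y' /=; rewrite shift_up_mix -[shift_up y']/(translate _ y').
  move=> ->; apply: slabf => v /andP[_ vm]; rewrite /mix ifT// /below /b.
  by lia.
move=> <-; apply: slabf => v /andP[_ vm]; rewrite /mix ifT// /below /b.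
by lia.
Qed.

Variable q : nat.
Hypothesis Cq : (#|C| <= q)%N.

(** For each of the at most [q] values, the event that it is taken while being unlikely has conditional probability at most [eps]. *)
Lemma unlikely_value : (mu [set y | f y \notin likely_values y] <= (q%:R * eps)%:E)%E.
Proof.
have mU c : measurable [set y | f y = c /\ c \notin likely_values y].
  exact: (measurable_rel (fun c1 (A : {set C}) => c1 = c /\ c \notin A)
     mf likely_values_measurable).
have hU c : c \in enum C ->
    (mu [set y | f y = c /\ c \notin likely_values y] <= eps%:E)%E.
  move=> _; apply: (resample_le iidY (A := below b)) => // y /=.
  have [cy|/negP cy] := boolP (c \in likely_values y).
    rewrite [X in mu X](_ : _ = set0) ?measure0 ?lee_fin ?ltW//.
    apply/seteqP; split => // y' /= [_ /negP]; apply.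
    by rewrite -(likely_values_slab (y := y))// => v /andP[_ vb]; rewrite /mix /below vb.
  have : ~ (eps%:E < h c y)%E by move=> hc; apply: cy; rewrite inE; apply/asboolP.
  move/negP; rewrite -leNgt; apply: le_trans.
  apply: le_measure; rewrite ?inE.
  - exact: (measurable_mix_section (below b) y (mU c)).
  - exact: (measurable_mix_section (below b) y (mf c)).
  - by move=> y' /= [].
have [mU' hU'] := union_bound mU hU.
apply: le_trans (le_trans hU' _).
  apply: le_measure; rewrite ?inE//.
  - exact: (measurable_rel (fun c (A : {set C}) => c \notin A) mf
       likely_values_measurable).
  - by move=> y /= hy; exists (f y); rewrite ?mem_enum.
by rewrite lee_fin; apply: ler_wpM2r; [exact: ltW|rewrite ler_nat -cardE].
Qed.

(** When both sets of likely values coincide, either [f] takes an unlikely value or its value is likely one step further. *)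
Lemma likely_agreement_bound :
  (mu [set y | likely_values y = likely_values (shift_up y)] <=
   mu [set y | f y \in likely_values (shift_up y)] + (q%:R * eps)%:E)%E.
Proof.
have ml := likely_values_measurable.
have mlu : simple_measurable (likely_values \o shift_up).
  by apply: simple_measurable_comp => //; exact: measurable_shift_up.
apply: (@le_trans _ _ (mu ([set y | f y \in likely_values (shift_up y)] `|`
   [set y | f y \notin likely_values y]))).
  apply: le_measure; rewrite ?inE.
  - exact: (measurable_rel (fun A A' : {set C} => A = A') ml mlu).
  - apply: measurableU.
      exact: (measurable_rel (fun c (A : {set C}) => c \in A) mf mlu).
    exact: (measurable_rel (fun c (A : {set C}) => c \notin A) mf ml).
  by move=> y /= <-; case: (boolP (f y \in _)) => ?; [left|right].
apply: (le_trans (measureU2 _ _ _)).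
- exact: (measurable_rel (fun c (A : {set C}) => c \in A) mf mlu).
- exact: (measurable_rel (fun c (A : {set C}) => c \notin A) mf ml).
by apply: leeD => //; exact: unlikely_value.
Qed.

End one_step.
End color_elimination.

(** * Iterated powers of two and the agreement bound *)

Definition pow2_tower (m x : nat) := iter m (expn 2) x.

Lemma pow2_tower_ge m x : (x <= pow2_tower m x)%N.
Proof. by elim: m => //= m; move/leq_trans; apply; exact/ltnW/ltn_expl. Qed.

Lemma pow2_tower_mono m x y : (x <= y)%N -> (pow2_tower m x <= pow2_tower m y)%N.
Proof. by move=> xy; elim: m => //= m IH; rewrite leq_exp2l. Qed.

(** Slack in the argument of the tower absorbs multiplicative losses made at its top. *)
Lemma pow2_tower_mul5 m x : (0 < x)%N -> (5 * pow2_tower m x <= pow2_tower m (5 * x))%N.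
Proof.
move=> x0; elim: m => //= m IH; rewrite -/(pow2_tower m x) -/(pow2_tower m (5 * x)).
apply: leq_trans (_ : 2 ^ (5 * pow2_tower m x) <= _)%N; last by rewrite leq_exp2l.
have := leq_trans x0 (pow2_tower_ge m x); case: (pow2_tower m x) => // k _.
have -> : (5 * k.+1 = (4 * k).+4 + k.+1)%N by lia.
rewrite expnD leq_mul2r; apply/orP; right.
by rewrite -(addn4 (4 * k)) expnD; have := expn_gt0 2 (4 * k); lia.
Qed.

(** In terms of binary logarithms, one elimination step doubles the exponent and adds 2 + q. *)
Lemma pow2_tower_budget m q : (2 <= q)%N ->
  (2 * pow2_tower m (3 * 2 ^ q) + 2 + q <= pow2_tower m.+1 (3 * q))%N.
Proof.
move=> q2; rewrite /pow2_tower iterSr -!/(pow2_tower _ _).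
set B := pow2_tower m (3 * 2 ^ q).
have B1 : (3 * 2 ^ q <= B)%N by exact: pow2_tower_ge.
have qe : (q < 2 ^ q)%N by exact: ltn_expl.
have e0 : (0 < 3 * 2 ^ q)%N by lia.
have h5 := pow2_tower_mul5 m e0.
have q16 : (16 <= 2 ^ (2 * q))%N by rewrite (@leq_exp2l 2 4)//; lia.
have h6 : (5 * (3 * 2 ^ q) <= 2 ^ (3 * q))%N.
  rewrite (_ : 3 * q = 2 * q + q)%N; last by lia.
  by rewrite expnD mulnA leq_mul2r; apply/orP; right; lia.
have := pow2_tower_mono m h6; rewrite -/B in h5 *; lia.
Qed.

(** A starting value [x] costs at most [x] further levels. *)
Lemma pow2_tower_le_height n x : (pow2_tower n x <= pow2_tower (n + x) 1)%N.
Proof.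
have h : (x < pow2_tower x 1)%N.
  by elim: x => //= x IH; apply: leq_ltn_trans (ltn_expl _ _).
by rewrite /pow2_tower iterD; exact/pow2_tower_mono/ltnW.
Qed.

Lemma expR_ge_pow2 (R : realType) (n : nat) : (2 ^ n)%:R <= expR (n%:R : R).
Proof.
rewrite -[n%:R]mulr1 mulrC expRM_natr natrX; apply: lerXn2r; rewrite ?nnegrE ?expR_ge0 ?ler0n//.
by apply: le_trans (expR_ge1Dx _); lra.
Qed.

Lemma pow2_tower_expR (R : realType) n :
  (pow2_tower n 1)%:R <= iter n (@expR R) 1.
Proof.
elim: n => //= n IH; apply: le_trans (expR_ge_pow2 _ _) _.
by rewrite ler_expR.
Qed.

Lemma iter_expR_mono (R : realType) m n : (m <= n)%N ->
  iter m (@expR R) 1 <= iter n (@expR R) 1.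
Proof.
move=> /subnKC <-; elim: (n - m)%N => [|k IH]; first by rewrite addn0.
rewrite addnS /=; apply: (le_trans IH).
by apply: le_trans (expR_ge1Dx _); lra.
Qed.

Lemma iter_expR_ge1 (R : realType) n : 1 <= iter n (@expR R) 1.
Proof. exact: (@iter_expR_mono R 0 n). Qed.

Section agreement.
Context (R : realType) (d : nat) (dS : measure_display) (S : measurableType dS)
  (dO : measure_display) (Omega : measurableType dO) (P : probability Omega R).
Variable Y : {RV P >-> labelings d S}.
Hypothesis iidY : iid_family P Y.
Variable i0 : 'I_d.
Local Notation mu := (distribution P Y).
Local Notation M := (labelings d S).
Local Notation step_up := (@shift_up d _ S i0).

(** Induction on the number of slabs: with no slab left [f] is constant, and a bound delta for the likely values gives delta^2 / (4 q) for [f], by taking eps = delta / (2 q). *)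
Lemma agreement_lower_bound m (C : finType) q a (f : M -> C) :
  (2 <= q)%N -> (#|C| <= q)%N -> simple_measurable f ->
  slab_function i0 a m f ->
  (((2 ^ pow2_tower m (3 * q))%:R^-1)%:E <= mu [set y | f y = f (step_up y)])%E.
Proof.
elim: m C q a f => [|m IH] C q a f q2 Cq mf slabf.
  have -> : [set y | f y = f (step_up y)] = setT.
    apply/seteqP; split => // y _ /=; apply: slabf => v.
    by move=> /andP[h1 h2]; exfalso; lia.
  by rewrite [X in (_ <= X)%E]law_setT lee_fin invf_le1 ?ltr0n ?ler1n ?expn_gt0.
set delta : R := (2 ^ pow2_tower m (3 * 2 ^ q))%:R^-1.
have d0 : 0 < delta by rewrite invr_gt0 ltr0n expn_gt0.
have q0 : 0 < q%:R :> R by rewrite ltr0n; lia.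
pose eps := delta / (2 * q%:R).
have e0 : 0 < eps by rewrite divr_gt0// mulr_gt0.
pose g := likely_values Y i0 a m f eps.
have mg : simple_measurable g by exact: likely_values_measurable.
have q2' : (2 <= 2 ^ q)%N by rewrite -{1}(expn1 2) leq_exp2l//; lia.
have cg : (#|{set C}| <= 2 ^ q)%N by rewrite -cardsT -powersetT card_powerset cardsT leq_exp2l.
have := IH _ _ _ _ q2' cg mg (likely_values_slab Y eps slabf).
rewrite -/delta => /le_trans /(_ (likely_agreement_bound iidY e0 mf slabf Cq)).
have := agreement_ge iidY e0 mf slabf.
set X := mu [set y | f y \in g (step_up y)].
have Xfin : X \is a fin_num.
  apply: fin_num_measure.
  apply: (measurable_rel (fun c (A : {set C}) => c \in A) mf).
  by apply: simple_measurable_comp => //; exact: measurable_shift_up.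
rewrite -(fineK Xfin) => h1 h2; apply: le_trans h1.
have qe : q%:R * eps = delta / 2 by rewrite /eps; field; rewrite gt_eqF.
move: h2; rewrite qe -EFinD -EFinM !lee_fin => h2.
have h3 : delta / 2 <= fine X by lra.
apply: (@le_trans _ _ (eps * (delta / 2))); last by rewrite ler_pM2l.
have -> : eps * (delta / 2) = (((2 ^ pow2_tower m (3 * 2 ^ q)) ^ 2 * (4 * q))%:R)^-1.
  have z0 : (2 ^ pow2_tower m (3 * 2 ^ q))%:R != 0 :> R by rewrite pnatr_eq0 expn_eq0.
  rewrite /eps /delta !natrM; field.
  by rewrite z0 gt_eqF.
rewrite lef_pV2 ?posrE ?ltr0n ?muln_gt0 ?expn_gt0//; last by lia.
(* The factor 4 q is at most 2 ^ (2 + q). *)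
rewrite ler_nat -expnM; apply: (@leq_trans (2 ^ (2 * pow2_tower m (3 * 2 ^ q) + 2 + q))%N).
  rewrite -addnA expnD (mulnC 2%N) leq_mul2l; apply/orP; right.
  by rewrite expnD (_ : 2 ^ 2 = 4)%N// leq_mul2l/=; exact/ltnW/ltn_expl.
by rewrite leq_exp2l//; exact: pow2_tower_budget.
Qed.

End agreement.

(** * Coding radius of a finitary coloring: lower bound *)

Section ffiid_lower_bound.
Context (R : realType) (d q : nat) (dO : measure_display)
  (Omega : measurableType dO) (P : probability Omega R)
  (X : Omega -> config d 'I_q)
  (dS : measure_display) (S : measurableType dS).
Variable Y : {RV P >-> labelings d S}.
Variable F : labelings d S -> config d 'I_q.
Hypothesis colX : coloring_process P X.
Hypothesis facX : ffiid P X Y F.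
Variable i0 : 'I_d.
Local Notation mu := (distribution P Y).
Local Notation M := (labelings d S).
Local Notation step_up := (@shift_up d _ S i0).
Let iidY : iid_family P Y. Proof. by have [] := facX. Qed.

Let F0 (y : M) : 'I_q := F y 0.

Let mF0 : simple_measurable F0.
Proof.
move=> a; have [_ mF _ _ _] := facX.
apply: (mF [set x : config d 'I_q | x 0 = a]).
apply: sub_sigma_algebra; exists 0 => //; exists [set a] => //.
by rewrite setTI.
Qed.

Lemma norm1_delta (i : 'I_d) : norm1 (delta_mx ord0 i : Zd d) = 1%N.
Proof.
rewrite /norm1 (bigD1 i)//= mxE !eqxx/= big1 ?addn0// => j ji.
by rewrite mxE (negbTE ji).
Qed.

(** The color one step further is the color at the origin of the translated labeling. *)
Lemma color_step_up_prob0 : mu [set y | F0 y = F0 (step_up y)] = 0%E.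
Proof.
have [_ _ eqF _ XF] := facX; have [_ aeX] := colX.
have mD : measurable [set y | F0 y = F0 (step_up y)].
  apply: (measurable_rel (fun c c' : 'I_q => c = c') mF0).
  by apply: simple_measurable_comp => //; exact: measurable_shift_up.
rewrite /distribution /pushforward; apply/negligibleP.
  exact: (measurable_funPTI Y mD).
apply: negligibleS aeX => w /= h hX.
apply: (hX (delta_mx ord0 i0) 0); first by rewrite subr0 norm1_delta.
rewrite XF; move: h; rewrite /F0 /shift_up eqF /translate add0r => h.
exact/esym.
Qed.

Lemma measurable_shift_up_preimage (D : set M) : measurable D ->
  measurable (step_up @^-1` D).
Proof. by move=> mD; rewrite -[X in measurable X]setTI; apply: measurable_shift_up. Qed.

Section radius.
Variable n : nat.

(** The sites of the 2n + 1 slabs around the origin; they contain the ball of radius [n]. *)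
Definition inner : pred (Zd d) := fun v => (`|v ord0 i0| <= n%:Z).

Let h (a : 'I_q) (y : M) : \bar R := mu [set y' | F0 (mix inner y y') = a].

(** The colors that the origin keeps almost surely when all labels outside the inner slabs are resampled. Unlike the labelings with coding radius at most n, which need not form a measurable set, the labelings with a forced color do. *)
Definition forced (y : M) : {set 'I_q} := [set a | `[< h a y = 1%E >]].

Lemma forced_inner (y y' : M) : (forall v : Zd d, inner v -> y v = y' v) ->
  forced y = forced y'.
Proof.
move=> yy'; apply/setP => a; rewrite !inE; congr (`[< _ = _ >]).
congr (mu _); apply/funext => z /=; congr (F0 _ = a).
by apply/funext => v; rewrite /mix; case: ifP => // /yy'.
Qed.

Lemma forced_measurable : simple_measurable forced.
Proof.
apply: simple_measurable_set => a.
have -> : [set y | a \in forced y] = h a @^-1` [set 1%E].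
  by apply/seteqP; split => y /=; rewrite inE => /asboolP.
rewrite -[X in measurable X]setTI.
by apply: (@measurable_resample _ _ _ _ _ _ _ Y inner (F0 @^-1` [set a])) => //;
  exact: emeasurable_set1.
Qed.

Let mforced_neq a : measurable [set y | a \in forced y /\ F0 y <> a].
Proof.
exact: (measurable_rel (fun (A : {set 'I_q}) c => a \in A /\ c <> a)
   forced_measurable mF0).
Qed.

Lemma forced_neq_prob0 a : (mu [set y | a \in forced y /\ F0 y <> a] <= 0%:E)%E.
Proof.
apply: (resample_le iidY (A := inner)) => // y.
have fy y' : forced (mix inner y y') = forced y.
  by apply: forced_inner => v iv; rewrite /mix iv.
have [ay|ay] := boolP (a \in forced y); last first.
  rewrite [X in mu X](_ : _ = set0) ?measure0//.
  by apply/seteqP; split => // y' /= []; rewrite fy (negbTE ay).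
have mB := @measurable_mix_section _ _ _ inner y _ (mF0 a).
rewrite [X in mu X](_ : _ = ~` [set y' | (F0 @^-1` [set a]) (mix inner y y')]).
  rewrite probability_setC//; move: ay; rewrite inE => /asboolP hay.
  by rewrite [X in (_ - X)%E]hay subee.
by apply/seteqP; split => y' /=; rewrite fy ay; [case|].
Qed.

(** The exceptional null event on which a forced color is not the actual color. *)
Definition misforced : set M := [set y | exists2 a, a \in enum 'I_q &
  (a \in forced y /\ F0 y <> a)].

Lemma measurable_misforced : measurable misforced.
Proof.
by have [] := @union_bound R _ _ mu _ (enum 'I_q)
  (fun a => [set y | a \in forced y /\ F0 y <> a]) 0 mforced_neq
  (fun a _ => forced_neq_prob0 a).
Qed.

Lemma misforced_prob0 : mu misforced = 0%E.
Proof.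
have [_] := @union_bound R _ _ mu _ (enum 'I_q)
  (fun a => [set y | a \in forced y /\ F0 y <> a]) 0 mforced_neq
  (fun a _ => forced_neq_prob0 a).
by rewrite mulr0 measure_le0 => /eqP.
Qed.

Definition forced_color (y : M) : option 'I_q := [pick a in forced y].

Lemma forced_color_measurable : simple_measurable forced_color.
Proof.
exact: (simple_measurable_post (fun A : {set 'I_q} => [pick a in A]) forced_measurable).
Qed.

Lemma forced_colorP y a : a \in forced y -> ~ misforced y -> F0 y = a.
Proof.
move=> ay my; apply: contrapT => h'; apply: my.
by exists a; [rewrite mem_enum|split].
Qed.

(** Up to null events, a color forced both at the origin and one step further would be shared by adjacent sites. *)
Lemma forced_agreement : [set y | (exists2 a, a \in forced y & a \in forced (step_up y))]
  `<=` misforced `|` step_up @^-1` misforced `|` [set y | F0 y = F0 (step_up y)].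
Proof.
move=> y [a ay ay']; have [my|my] := pselect (misforced y); first by left; left.
have [my'|my'] := pselect (misforced (step_up y)); first by left; right.
by right => /=; rewrite (forced_colorP ay my) (forced_colorP ay' my').
Qed.

Lemma forced_agreement_prob0 :
  mu (misforced `|` step_up @^-1` misforced `|` [set y | F0 y = F0 (step_up y)]) = 0%E.
Proof.
have mm := measurable_misforced.
have mms := measurable_shift_up_preimage mm.
have mD : measurable [set y | F0 y = F0 (step_up y)].
  apply: (measurable_rel (fun c c' : 'I_q => c = c') mF0).
  by apply: simple_measurable_comp => //; exact: measurable_shift_up.
apply/eqP; rewrite -measure_le0.
apply: (le_trans (measureU2 _ _ _)) => //; first exact: measurableU.
rewrite [X in (_ + X)%E]color_step_up_prob0 adde0.
apply: (le_trans (measureU2 _ _ _)) => //.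
by rewrite [X in (X + _)%E]misforced_prob0 add0e [X in (X <= _)%E](law_translate iidY (delta_mx ord0 i0))// misforced_prob0.
Qed.

Definition unforced : set M := [set y | forced_color y = None].

Lemma measurable_unforced : measurable unforced.
Proof. exact: (forced_color_measurable None). Qed.

(** If some radius at most [n] determines the color, then no resampling outside the inner slabs can change it, so it is forced. *)
Lemma unforced_tail (r : R) : r < n.+1%:R ->
  (mu unforced <= coding_radius_tail P Y F r)%E.
Proof.
move=> rn.
have -> : mu unforced = (P^*)%mu (Y @^-1` unforced).
  rewrite measurable_mu_extE//; exact: (measurable_funPTI Y measurable_unforced).
apply: le_mu_ext => w /=; rewrite /unforced /forced_color/= => hw.
apply: (@lt_le_trans _ _ (n.+1%:R%:E)); first by rewrite lte_fin.
apply: le_ereal_inf_tmp => _ [k /= kdet <-]; rewrite lee_fin ler_nat leqNgt.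
apply/negP => kn; move: hw; case: pickP => // /(_ (F0 (Y w)))/negP + _; apply.
rewrite inE; apply/asboolP; rewrite /h.
rewrite (_ : [set _ | _] = setT) ?law_setT//; apply/seteqP; split => // y' _ /=.
apply: kdet => v vk; rewrite /mix ifT// /inner.
have h1 : (`|v ord0 i0|%N <= norm1 v)%N by rewrite /norm1 (bigD1 i0)//= leq_addr.
have := leq_trans h1 (leq_trans vk (ltnSE kn)); lia.
Qed.

(** The forced color is a function of 2n + 1 slabs with values in an option type; it agrees with its translate only if it is undefined at one of two adjacent sites. *)
Lemma unforced_lower_bound :
  (((2 ^ pow2_tower (2 * n).+1 (3 * q.+2))%:R^-1)%:E <= 2%:E * mu unforced)%E.
Proof.
have slabf : slab_function i0 (- n%:Z) (2 * n).+1 forced_color.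
  move=> y y' yy'; rewrite /forced_color (forced_inner (y' := y'))// => v iv.
  by apply: yy'; move: iv; rewrite /inner; lia.
have q2 : (2 <= q.+2)%N by [].
have cq : (#|{: option 'I_q}| <= q.+2)%N by rewrite card_option card_ord.
apply: le_trans (agreement_lower_bound iidY q2 cq forced_color_measurable slabf) _.
set Z := misforced `|` step_up @^-1` misforced `|` [set y | F0 y = F0 (step_up y)].
have mZ : measurable Z.
  apply: measurableU; first apply: measurableU.
  - exact: measurable_misforced.
  - apply: measurable_shift_up_preimage; exact: measurable_misforced.
  - apply: (measurable_rel (fun c c' : 'I_q => c = c') mF0).
    by apply: simple_measurable_comp => //; exact: measurable_shift_up.
have mN := measurable_unforced.
apply: (@le_trans _ _ (mu (unforced `|` Z))).
  apply: le_measure; rewrite ?inE; last 1 first.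
  - move=> y /= hy; have [fy|fy] := boolP (forced_color y == None); first by left; apply/eqP.
    right; apply: forced_agreement => /=.
    move: fy hy; rewrite /forced_color.
    case: pickP => // a ay _; case: pickP => // b yb [ab].
    by exists a; [exact: ay|rewrite ab].
  - apply: (measurable_rel (fun c c' : option 'I_q => c = c') forced_color_measurable).
    apply: simple_measurable_comp; first exact: measurable_shift_up.
    exact: forced_color_measurable.
  - exact: measurableU.
apply: (le_trans (measureU2 _ _ _)) => //.
rewrite [X in (_ + X)%E]forced_agreement_prob0 adde0.
by rewrite -[X in (X <= _)%E]mul1e lee_wpmul2r// lee_fin ler1n.
Qed.

End radius.

(** At radius 0 the forced color depends on one slab, and adjacent slabs are independent: a color forced with probability p would be forced at two adjacent sites with probability p^2, which vanishes. *)
Lemma unforced_prob1 : mu (unforced 0) = 1%E.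
Proof.
have mH a : measurable [set y | a \in forced 0 y].
  exact: (measurable_rel (fun (A A' : {set 'I_q}) => a \in A)
    (@forced_measurable 0) (@forced_measurable 0)).
have H0 a : mu [set y | a \in forced 0 y] = 0%E.
  set H := [set y | _]; set Z := H `&` step_up @^-1` H.
  have mZ : measurable Z.
    apply: measurableI; [exact: mH|exact: measurable_shift_up_preimage (mH a)].
  have fH : mu H \is a fin_num by apply: fin_num_measure; exact: mH.
  have : ((fine (mu H))%:E * mu H <= mu Z)%E.
    apply: (resample_ge iidY (A := below i0 (0 + 1)));
      [by rewrite fine_ge0|exact: mH|exact: mZ|move=> y Hy].
    rewrite fineK// -[X in (X <= _)%E](law_translate iidY (delta_mx ord0 i0)); last exact: mH.
    rewrite le_eqVlt; apply/orP; left; apply/eqP; congr (mu _).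
    apply/seteqP; split => y' /=.
    - move=> h; split => /=.
        rewrite /H/= (@forced_inner 0 _ y)// => v; rewrite /inner /mix /below.
        by case: ifP => // /negP; lia.
      rewrite /H/= shift_up_mix (@forced_inner 0 _ (step_up y'))// => v.
      by rewrite /inner /mix /below; case: ifP => //; lia.
    - move=> [_]; rewrite /H/= shift_up_mix (@forced_inner 0 _ (step_up y'))// => v.
      by rewrite /inner /mix /below; case: ifP => //; lia.
  have Z0 : mu Z = 0%E.
    apply/eqP; rewrite -measure_le0 -(@forced_agreement_prob0 0); apply: le_measure; rewrite ?inE//.
    - apply: measurableU; first apply: measurableU.
      + exact: measurable_misforced.
      + apply: measurable_shift_up_preimage; exact: measurable_misforced.
      + apply: (measurable_rel (fun c c' : 'I_q => c = c') mF0).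
        by apply: simple_measurable_comp => //; exact: measurable_shift_up.
    - move=> y [] /= h1 h2; apply: forced_agreement; by exists a.
  rewrite [X in (_ <= X)%E]Z0 -(fineK fH) -EFinM lee_fin => hh.
  have /eqP : fine (mu H) ^+ 2 = 0.
    apply/eqP; rewrite eq_le exprn_even_ge0// andbT expr2; exact: hh.
  by rewrite sqrf_eq0 => /eqP ->.
have mU : measurable (~` unforced 0) by apply: measurableC; exact: measurable_unforced.
rewrite -[unforced 0]setCK probability_setC//.
suff hU0 : mu (~` unforced 0) = 0%E by rewrite [X in (_ - X)%E]hU0 sube0.
apply/eqP; rewrite -measure_le0.
have [mV hV] := @union_bound R _ _ mu _ (enum 'I_q) (fun a => [set y | a \in forced 0 y]) 0
  mH (fun a _ => eq_ind_r (fun z => z <= 0%:E)%E (lexx _) (H0 a)).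
rewrite mulr0 in hV; apply: le_trans hV; apply: le_measure; rewrite ?inE//.
move=> y /=; rewrite /unforced/= /forced_color; case: pickP => // a ay _.
by exists a; rewrite ?mem_enum.
Qed.

(** For r < 1 the claim is that R > 0 almost surely. For larger r, with n the floor of r, the slabs, the palette and the constant factors cost 2n + 9 + 3q levels in total, which is at most (3q + 11) n. *)
Lemma coding_radius_tail_ge (r : R) : 0 <= r ->
  ((1 / tower ((3 * q + 11)%:R * r))%:E <= coding_radius_tail P Y F r)%E.
Proof.
move=> r0; have /andP[tr rt] := truncn_itv r0; set n := Num.truncn r in tr rt.
apply: le_trans (@unforced_tail n r rt).
have [n0|n0] := posnP n.
  rewrite n0 unforced_prob1 lee_fin div1r invf_le1 ?iter_expR_ge1//.
  exact: lt_le_trans (iter_expR_ge1 _ _).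
have := unforced_lower_bound n.
have fN : mu (unforced n) \is a fin_num.
  by apply: fin_num_measure; exact: measurable_unforced.
rewrite -(fineK fN) -EFinM !lee_fin => h.
set p := pow2_tower _ _ in h.
have h2 : (2 * 2 ^ p)%:R^-1 <= fine (mu (unforced n)).
  by rewrite natrM invfM; lra.
apply: le_trans h2.
rewrite div1r lef_pV2 ?posrE ?ltr0n ?muln_gt0 ?expn_gt0//; last first.
  exact: lt_le_trans (iter_expR_ge1 _ _).
apply: (@le_trans _ _ (pow2_tower ((2 * n).+3 + 3 * q.+2) 1)%:R).
  rewrite ler_nat; apply: leq_trans (pow2_tower_le_height _ _).
  by rewrite -expnS /= leq_exp2l//; exact: ltn_expl.
apply: le_trans (pow2_tower_expR _ _) _; apply: iter_expR_mono.
rewrite -(ler_nat R); apply: (@le_trans _ _ ((3 * q + 11) * n)%:R).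
  by rewrite ler_nat; nia.
rewrite ler_nat truncn_ge_nat ?mulr_ge0//.
by rewrite natrM ler_wpM2l.
Qed.

End ffiid_lower_bound.

(** * Color reduction by first differing bits, and greedy assignments *)

Definition first_diff (s t : nat -> bool) : nat :=
  if pselect (exists i, s i != t i) is left h then ex_minn h else 0%N.

(** The code a Cole-Vishkin step assigns to [s] when the next label is [t]: a position where they differ, together with the bit of [s] there. *)
Definition diff_code (s t : nat -> bool) : nat :=
  (2 * first_diff s t + s (first_diff s t))%N.

Lemma first_diff_neq s t : (exists i, s i != t i) ->
  s (first_diff s t) != t (first_diff s t).
Proof. by rewrite /first_diff; case: pselect => // h _; case: ex_minnP. Qed.

Lemma first_diff_le s t i : s i != t i -> (first_diff s t <= i)%N.
Proof.
rewrite /first_diff => sti; case: pselect => [h|[]]; last by exists i.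
by case: ex_minnP => n _; apply.
Qed.

(** Equal codes would name a position where [s] and [t] differ, and at which both have the bit recorded in the code. *)
Lemma diff_code_neq s t u : (exists i, s i != t i) -> (exists i, t i != u i) ->
  diff_code s t != diff_code t u.
Proof.
move=> st tu; have := first_diff_neq st; apply: contra => /eqP.
rewrite /diff_code => E.
have E1 : first_diff s t = first_diff t u.
  by move: E; case: (s _); case: (t _) => /=; lia.
by move: E; rewrite E1; case: (s _); case: (t _) => //=; lia.
Qed.

Lemma diff_code_lt s t i m : s i != t i -> (i < m)%N -> (diff_code s t < 2 * m)%N.
Proof. by move=> /first_diff_le; rewrite /diff_code; case: (s _) => /=; lia. Qed.

Definition bits (n : nat) : nat -> bool := fun i => odd (n %/ 2 ^ i).

Lemma bits_neq m a b : (a < 2 ^ m)%N -> (b < 2 ^ m)%N -> a != b ->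
  exists2 i, (i < m)%N & bits a i != bits b i.
Proof.
elim: m a b => [|m IH] a b am bm ab; first by move: am bm ab; rewrite !expn0; case: a b => [|a] [|b].
have [oab|oab] := boolP (odd a == odd b); last by exists 0%N => //; rewrite /bits !divn1.
have [] := IH (a %/ 2)%N (b %/ 2)%N; rewrite ?ltn_divLR// -?expnSr//.
  apply: contra ab => /eqP h; apply/eqP.
  by rewrite (divn_eq a 2) (divn_eq b 2) h !modn2 (eqP oab).
by move=> i im h; exists i.+1 => //; move: h; rewrite /bits !expnS !divnMA.
Qed.

(** The bounds on first differing positions that n rounds of reduction can handle: [2 * threshold n.+1 = 2 ^ threshold n], so a round turns labels below the former into labels below [2 * threshold n]. *)
Fixpoint threshold (n : nat) : nat := if n is n'.+1 then (2 ^ (threshold n').-1)%N else 3%N.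

Section color_reduction.
Variable d : nat.
Implicit Types (a : Zd d -> Zd d -> nat) (u v e : Zd d).

(** One round along each direction [e] separately: [a v e] is the label of [v] on its line of direction [e]. *)
Definition reduce a : Zd d -> Zd d -> nat :=
  fun v e => diff_code (bits (a v e)) (bits (a (v + e) e)).

Definition reduced n a := iter n reduce a.

Definition proper_along e a := forall v, a v e != a (v + e) e.

Lemma reduce_proper e a : proper_along e a -> proper_along e (reduce a).
Proof.
move=> pa v; have bn x y : x != y -> exists i, bits x i != bits y i.
  move=> xy; have le : (x + y < 2 ^ (x + y))%N by exact: ltn_expl.
  have [] := @bits_neq (x + y)%N x y _ _ xy.
  - by lia.
  - by lia.
  - by move=> i _; exists i.
by apply: diff_code_neq; apply: bn; exact: pa.
Qed.

Lemma reduced_proper e n a : proper_along e a -> proper_along e (reduced n a).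
Proof. by move=> pa; elim: n => //= n; exact: reduce_proper. Qed.

Lemma threshold_gt0 n : (0 < threshold n)%N.
Proof. by case: n => //= n; rewrite expn_gt0. Qed.

(** After k rounds the labels along the line are below [2 * threshold (n - k)], and [2 * threshold 0 = 6]. *)
Lemma reduced_lt6 n a v e : proper_along e a ->
  (forall i, (i <= n)%N -> (a (v + e *+ i)%R e < 2 * threshold n)%N) ->
  (reduced n a v e < 6)%N.
Proof.
elim: n a => [|n IH] a pa ha; first by have := ha 0%N isT; rewrite mulr0n addr0.
rewrite /reduced iterSr; apply: IH; first exact: reduce_proper.
move=> i ilen.
have T : (2 * threshold n.+1 = 2 ^ threshold n)%N.
  by rewrite /= -expnS prednK// threshold_gt0.
have h1 := ha i (leqW ilen); have h2 := ha i.+1 ilen.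
rewrite T in h1 h2; rewrite mulrSr addrA in h2.
have [j jn bj] := bits_neq h1 h2 (pa _).
exact: diff_code_lt bj jn.
Qed.

End color_reduction.

Section greedy.
Variables (d : nat) (A : Type) (E : seq (Zd d)).
Variable choose : (Zd d -> option A) -> A.
Implicit Types (a : Zd d -> Zd d -> nat) (u v e : Zd d).

(** A greedy assignment processed in the order of [tau]: sites whose difference is in [E] have different times, and a site chooses in view of those neighbors that come earlier. *)
Definition greedy (m : Zd d -> A) (tau : Zd d -> nat) : Prop :=
  (forall v e, e \in E -> tau (v + e) <> tau v) /\
  (forall v, m v = choose (fun e =>
     if (e \in E) && (tau (v + e)%R < tau v)%N then Some (m (v + e)) else None)).

Definition palette := {ffun 'I_(size E) -> 'I_6}.
Definition palette_size := #|{: palette}|.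

Lemma palette_size_gt0 : (0 < palette_size)%N.
Proof. by apply/card_gt0P; exists [ffun=> ord0]. Qed.

(** Time [t] encodes a number of rounds and a tuple of labels, one for each direction of [E]; it is the turn of the sites that have exactly these labels after that many rounds. A site can have several turns, of which only the first one matters. *)
Definition turn a (t : nat) v : bool :=
  [exists p : palette, (enum_rank p == (t %% palette_size)%N :> nat) &&
   [forall i : 'I_(size E), reduced (t %/ palette_size) a v (nth 0 E i) == p i]].

Fixpoint assigned a t v : option A :=
  if t is t'.+1 then
    if assigned a t' v is Some s then Some s
    else if turn a t' v then
      Some (choose (fun e => if e \in E then assigned a t' (v + e) else None))
    else None
  else None.

Lemma assigned_mono a t t' v s : (t <= t')%N ->
  assigned a t v = Some s -> assigned a t' v = Some s.
Proof.
move=> /subnKC <-; elim: (t' - t)%N => [|k IH] h; first by rewrite addn0.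
by rewrite addnS /= IH.
Qed.

(** Having the same turn means having equal labels in the direction that separates the two sites. *)
Lemma turn_proper a t v e : e \in E -> proper_along e a -> turn a t v ->
  turn a t (v + e) -> False.
Proof.
move=> eE pa /existsP[p /andP[/eqP pt /forallP hp]] /existsP[p' /andP[/eqP p't /forallP hp']].
have pp' : p = p' by apply: enum_rank_inj; apply: val_inj; rewrite /= pt p't.
have iE : (index e E < size E)%N by rewrite index_mem.
have := hp (Ordinal iE); have := hp' (Ordinal iE); rewrite pp' /= nth_index// => /eqP h1 /eqP h2.
by have := reduced_proper (t %/ palette_size) pa v; rewrite h1 h2 eqxx.
Qed.

(** The labels after n rounds form a palette element, whose turn comes before the rounds exceed n. *)
Lemma assigned_by a n v :
  (forall e, e \in E -> (reduced n a v e < 6)%N) ->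
  assigned a (palette_size * n.+1)%N v <> None.
Proof.
move=> h; pose p : palette := [ffun i : 'I_(size E) => inord (reduced n a v (nth 0 E i))].
pose t := (n * palette_size + enum_rank p)%N.
have pr : (enum_rank p < palette_size)%N by exact: ltn_ord.
have tv : turn a t v.
  apply/existsP; exists p; rewrite /t modnMDl modn_small// eqxx/=.
  rewrite divnMDl ?palette_size_gt0// divn_small// addn0.
  by apply/forallP => i; rewrite ffunE inordK//; apply: h; exact: mem_nth.
have [s hs] : exists s, assigned a t.+1 v = Some s.
  by rewrite /=; case: (assigned a t v) => [s|]; [exists s|rewrite tv; eexists].
by rewrite (assigned_mono _ hs)// /t; nia.
Qed.

(** The time of a site is its first turn. At that moment exactly the neighbors with an earlier time have a value. *)
Lemma greedy_assigned a : (forall e, e \in E -> proper_along e a) ->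
  (forall v, exists t, assigned a t v <> None) ->
  exists (m : Zd d -> A) (tau : Zd d -> nat), greedy m tau /\
    forall v, assigned a (tau v).+1 v = Some (m v).
Proof.
move=> pa ha.
have hx v : exists tm : nat * A, [/\ assigned a tm.1 v = None,
    assigned a tm.1.+1 v = Some tm.2 & turn a tm.1 v].
  have ex : exists t, isSome (assigned a t v).
    by have [t ht] := ha v; exists t; move: ht; case: (assigned a t v).
  case: (ex_minnP ex) => -[//|t]; case E1 : (assigned a t.+1 v) => [s|//] _ mint.
  have tN : assigned a t v = None.
    by case E2 : (assigned a t v) (mint t) => // /(_ isT); rewrite ltnn.
  exists (t, s); split => //.
  by move: E1; rewrite /= tN; case: ifP.
have [f hf] := choice hx.
pose m v := (f v).2; pose tau v := (f v).1.
have am v : assigned a (tau v).+1 v = Some (m v) by case: (hf v).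
exists m, tau; split => //; split.
  move=> v e eE tt; have [_ _ t1] := hf v; have [_ _ t2] := hf (v + e).
  rewrite -/(tau (v + e)) tt in t2.
  exact: (turn_proper eE (pa e eE) t1 t2).
move=> v; have [aN aS tv] := hf v; move: aS; rewrite /= aN tv => -[aS]; rewrite {1}/m -aS.
congr choose; apply/funext => e; case: (boolP (e \in E)) => //= eE.
rewrite -/(tau v); case: ltnP => [lt|le]; first exact: (assigned_mono lt).
have [aN' _ _] := hf (v + e).
case E2 : (assigned a (tau v) (v + e)) => [s|//].
by rewrite (assigned_mono le E2) in aN'.
Qed.

Lemma reduced_translate u n a v e :
  reduced n (fun w => a (w + u)) v e = reduced n a (v + u) e.
Proof. by elim: n v => //= n IH v; rewrite /reduce !IH addrAC. Qed.

Lemma turn_translate u a t v : turn (fun w => a (w + u)) t v = turn a t (v + u).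
Proof.
by apply: eq_existsb => p; congr andb; apply: eq_forallb => i; rewrite reduced_translate.
Qed.

Lemma assigned_translate u a t v :
  assigned (fun w => a (w + u)) t v = assigned a t (v + u).
Proof.
elim: t v => //= t IH v; rewrite IH turn_translate.
congr (if assigned a t (v + u) is Some s then Some s else if turn a t (v + u) then Some (choose _) else None).
by apply/funext => e; rewrite IH addrAC.
Qed.

Variable k : nat.
Hypothesis Ek : forall e, e \in E -> (norm1 e <= k)%N.

Definition same_near v N a a' :=
  forall u, (norm1 (u - v) <= N)%N -> forall e, e \in E -> a u e = a' u e.

Lemma norm1D (u v : Zd d) : (norm1 (u + v)%R <= norm1 u + norm1 v)%N.
Proof.
rewrite /norm1 -big_split/=; apply: leq_sum => i _; by rewrite mxE -lez_nat PoszD !abszE ler_normD.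
Qed.

Lemma same_near_shift v e N N' a a' : e \in E -> (N + k <= N')%N ->
  same_near v N' a a' -> same_near (v + e) N a a'.
Proof.
move=> eE NN h u hu; apply: h; rewrite (_ : u - v = u - (v + e) + e); last by rewrite opprD addrA subrK.
by apply: leq_trans (norm1D _ _) _; have := Ek eE; lia.
Qed.

Lemma same_near_le v N N' a a' : (N <= N')%N -> same_near v N' a a' -> same_near v N a a'.
Proof. by move=> NN h u hu; apply: h; exact: leq_trans NN. Qed.

Lemma reduced_local n a a' v e : e \in E -> same_near v (k * n) a a' ->
  reduced n a v e = reduced n a' v e.
Proof.
move=> eE; elim: n v => [|n IH] v h /=.
  by apply: h => //; rewrite subrr /norm1 big1// => i _; rewrite mxE.
rewrite /reduce !IH//; last by apply: same_near_le h; rewrite leq_mul2l leqnSn orbT.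
by apply: same_near_shift h => //; rewrite mulnS addnC.
Qed.

(** Each time step looks one neighbor further, and the rounds of color reduction performed by time [t], at most [t] in number, account for a second [k * t]. *)
Lemma assigned_local t a a' v : same_near v (2 * k * t) a a' ->
  assigned a t v = assigned a' t v.
Proof.
elim: t v => //= t IH v h.
rewrite (IH v); last by apply: same_near_le h; rewrite leq_mul2l leqnSn orbT.
have -> : turn a t v = turn a' t v.
  apply: eq_existsb => p; congr andb; apply: eq_forallb => i.
  rewrite (@reduced_local _ a a')//; first exact: mem_nth.
  apply: same_near_le h; rewrite (mulnC 2 k) -mulnA leq_mul2l; apply/orP; right.
  have := leq_div t palette_size; lia.
congr (if assigned a' t v is Some s then Some s else if turn a' t v then Some (choose _) else None).
apply/funext => e; case: ifP => // eE; apply: IH.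
by apply: same_near_shift h => //; lia.
Qed.

End greedy.

(** * Boxes, local rules and the three-coloring of the line *)

Section boxes.
Variable d : nat.
Implicit Types u v w : Zd d.

Definition inbox (N : nat) w : bool := [forall i, - N%:Z <= w ord0 i <= N%:Z].

Definition box_list (N : nat) : seq (Zd d) :=
  [seq \row_i ((f i)%:Z - N%:Z) | f : {ffun 'I_d -> 'I_(2 * N).+1}].

Lemma inboxP N w : reflect (forall i, - N%:Z <= w ord0 i <= N%:Z) (inbox N w).
Proof. exact: forallP. Qed.

Lemma mem_box_list N w : (w \in box_list N) = inbox N w.
Proof.
apply/mapP/inboxP => [[f _ ->] i|h].
  by rewrite mxE; have := ltn_ord (f i); move: (nat_of_ord (f i)) => k; lia.
exists [ffun i => inord (absz (w ord0 i + N%:Z))]; rewrite ?mem_enum//.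
apply/rowP => i; rewrite mxE ffunE; have := h i; move: (w ord0 i) => x hx.
by rewrite inordK; lia.
Qed.

Lemma inbox_le N N' w : (N <= N')%N -> inbox N w -> inbox N' w.
Proof. by move=> NN /inboxP h; apply/inboxP => i; have := h i; lia. Qed.

Lemma inboxD N N' w w' : inbox N w -> inbox N' w' -> inbox (N + N') (w + w').
Proof.
move=> /inboxP h /inboxP h'; apply/inboxP => i; rewrite mxE.
by have := h i; have := h' i; move: (w ord0 i) (w' ord0 i) => x x'; lia.
Qed.

Lemma inboxN N w : inbox N (- w) = inbox N w.
Proof. by apply: eq_forallb => i; rewrite mxE; move: (w ord0 i) => x; apply/idP/idP; lia. Qed.

Lemma inboxB N w w' : inbox N (w - w') = inbox N (w' - w).
Proof. by rewrite -inboxN opprB. Qed.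

Lemma inbox0 N : inbox N 0.
Proof. by apply/inboxP => i; rewrite mxE; lia. Qed.

Lemma inbox_norm1 w N : (norm1 w <= N)%N -> inbox N w.
Proof.
move=> h; apply/inboxP => i; have : (`|w ord0 i|%N <= norm1 w)%N.
  by rewrite /norm1 (bigD1 i)//= leq_addr.
by lia.
Qed.

Local Notation unit_vec i := (delta_mx ord0 i : Zd d).

Lemma unit_vecE (i j : 'I_d) : unit_vec i ord0 j = (j == i)%:R :> int.
Proof. by rewrite mxE eqxx. Qed.

Lemma norm1_eq1 w : norm1 w = 1%N -> exists i, w = unit_vec i \/ w = - unit_vec i.
Proof.
rewrite /norm1 => h.
have [i wi|w0] := pickP (fun i => w ord0 i != 0); last first.
  by rewrite big1 in h => // i _; have := w0 i => /negbFE/eqP ->.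
exists i; rewrite (bigD1 i)//= in h.
have s0 : (\sum_(j < d | j != i) `|w ord0 j| = 0)%N.
  by move: h wi; move: (\sum_(j < d | j != i) _)%N (w ord0 i) => s x; lia.
have wj j : j != i -> w ord0 j = 0.
  move=> ji; have := s0; rewrite (bigD1 j)//=; move: (\sum_(_ < d | _) _)%N (w ord0 j) => s x; lia.
have [wi1|wi1] : w ord0 i = 1 \/ w ord0 i = -1.
  by move: h wi; rewrite s0; move: (w ord0 i) => x; lia.
- left; apply/rowP => j; rewrite unit_vecE; have [->|ji] := eqVneq j i; first by rewrite wi1.
  by rewrite wj.
- right; apply/rowP => j; rewrite mxE unit_vecE.
  by have [->|ji] := eqVneq j i; rewrite ?wi1// wj// oppr0.
Qed.

Lemma odd_norm1D w i : odd (norm1 (w + unit_vec i)) = ~~ odd (norm1 w).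
Proof.
rewrite /norm1 (bigD1 i)//= [in RHS](bigD1 i)//= !mxE !eqxx/=.
rewrite (eq_bigr (fun j => `|w ord0 j|%N)); last first.
  by move=> j ji; rewrite !mxE (negbTE ji) andbF addr0.
rewrite !oddD -addNb; congr addb; rewrite /=.
move: (w ord0 i) => x; have [x0|x0] : (0 <= x) \/ (x < 0) by lia.
  by have -> : absz (x + 1)%R = (absz x).+1 by lia.
by have -> : absz x = (absz (x + 1)%R).+1; [lia|rewrite /= negbK].
Qed.

End boxes.

Notation unit_vec i := (delta_mx ord0 i).

Definition truncate (d : nat) (A : Type) (W : seq (Zd d)) (a0 : A) (m : Zd d -> A) :=
  fun v => if v \in W then m v else a0.

(** A greedy choice followed by a map [Psi] that sees the result on a finite window [W] and produces a proper coloring, whatever the order of processing. Outside the window the configuration is filled with the arbitrary value [choose (fun=> None)]. *)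
Definition local_rule (d q : nat) : Prop :=
  exists (A : Type) (E W : seq (Zd d)) (choose : (Zd d -> option A) -> A)
    (Psi : (Zd d -> A) -> 'I_q),
    0 \notin E /\
    forall m tau, greedy E choose m tau ->
    forall u v, norm1 (u - v) = 1%N ->
      Psi (truncate W (choose (fun=> None)) (translate u m)) <>
      Psi (truncate W (choose (fun=> None)) (translate v m)).

Lemma greedy_earlier (d : nat) A (E : seq (Zd d)) choose (m : Zd d -> A) tau u v :
  greedy E choose m tau -> (v - u) \in E -> (u - v) \in E ->
  (tau u < tau v)%N \/ (tau v < tau u)%N.
Proof.
move=> [tE _] uv vu; have := tE u _ uv; rewrite addrC subrK; lia.
Qed.

Lemma greedy_sees (d : nat) A (E : seq (Zd d)) choose (m : Zd d -> A) tau u v :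
  greedy E choose m tau -> (u - v) \in E -> (tau u < tau v)%N ->
  exists2 sigma : Zd d -> option A, m v = choose sigma & sigma (u - v) = Some (m u).
Proof.
move=> [_ mE] uv tuv; rewrite mE; eexists; first by [].
by rewrite /= uv addrC subrK tuv.
Qed.

Section line.
Variable q : nat.
Hypothesis q3 : (3 <= q.+1)%N.

Definition avoid_neighbors (sigma : Zd 1 -> option 'I_q.+1) : 'I_q.+1 :=
  odflt ord0 [pick c | (sigma (unit_vec ord0) != Some c) && (sigma (- unit_vec ord0) != Some c)].

(** Two neighbors exclude at most two of at least three colors. *)
Lemma avoid_neighborsP sigma e : e \in [:: unit_vec ord0; - unit_vec ord0 : Zd 1] ->
  sigma e <> Some (avoid_neighbors sigma).
Proof.
move=> eE; rewrite /avoid_neighbors; case: pickP => [c /andP[/eqP h1 /eqP h2]|h] /=.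
  by move: eE; rewrite !inE => /orP[/eqP ->|/eqP ->].
exfalso.
pose c1 := odflt ord0 (sigma (unit_vec ord0)); pose c2 := odflt ord0 (sigma (- unit_vec ord0)).
have : (#|[set c1; c2]%SET| < #|[set: 'I_q.+1]%SET|)%N.
  rewrite cardsT card_ord; apply: leq_trans q3; rewrite ltnS.
  by rewrite cards2; case: (_ != _).
rewrite ltnNge => /negP; apply; apply: subset_leq_card; apply/fintype.subsetP => c _.
have := h c; rewrite !inE => /negbT; rewrite negb_and !negbK /c1 /c2.
by move=> /orP[/eqP ->|/eqP ->]; rewrite eqxx ?orbT.
Qed.

Lemma local_rule_line : local_rule 1 q.+1.
Proof.
exists 'I_q.+1, [:: unit_vec ord0; - unit_vec ord0], [:: 0], avoid_neighbors, (fun m => m 0).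
split.
  rewrite !inE negb_or; apply/andP; split; apply/eqP => /rowP /(_ ord0); rewrite !mxE//.
move=> m tau gm u v uv; rewrite /truncate /translate inE eqxx !add0r.
have {uv}h : u - v \in [:: unit_vec ord0; - unit_vec ord0 : Zd 1].
  by have [i] := norm1_eq1 uv; rewrite (ord1 i) !inE => -[->|->]; rewrite eqxx ?orbT.
have h' : v - u \in [:: unit_vec ord0; - unit_vec ord0 : Zd 1].
  move: h; rewrite -(opprB u v) !inE eqr_opp eqr_oppLR orbC //.
have key x y : x - y \in [:: unit_vec ord0; - unit_vec ord0 : Zd 1] ->
    (tau x < tau y)%N -> m x <> m y.
  move=> xy txy; have [sigma -> sx] := greedy_sees gm xy txy.
  by move=> mx; apply: (avoid_neighborsP (sigma := sigma) xy); rewrite sx mx.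
have [t|t] := greedy_earlier gm h' h; first exact: key.
by apply/nesym/key.
Qed.

End line.

(** * Anchors whose boxes have walls that keep apart *)

Section anchors.
Variable d : nat.
Implicit Types u v w x y z : Zd d.

(** A constant naming the coordinates, so that arithmetic decision procedures see them as atoms of type int. *)
Definition coord w (i : 'I_d) : int := w ord0 i.

Lemma coordD u v i : coord (u + v) i = coord u i + coord v i.
Proof. by rewrite /coord mxE. Qed.
Lemma coordN u i : coord (- u) i = - coord u i.
Proof. by rewrite /coord mxE. Qed.
Lemma coordB u v i : coord (u - v) i = coord u i - coord v i.
Proof. by rewrite coordD coordN. Qed.
Lemma coord_unit i j : coord (unit_vec i) j = (j == i)%:Z.
Proof. by rewrite /coord unit_vecE; case: (j == i). Qed.
Lemma inbox_coordP N w : reflect (forall i, - N%:Z <= coord w i <= N%:Z) (inbox N w).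
Proof. exact: inboxP. Qed.

(** The box of radius 5 sep is cut into 11^d cells of side sep, and a cell contains at most one anchor. *)
Definition crowd : nat := (11 ^ d)%N.
(** The separation of anchors, and the number of radii available to each of them, which has to exceed the number 12 d + 1 of radii excluded by each of at most [crowd] other anchors. *)
Definition sep : nat := (crowd * (12 * d + 1) + 4)%N.

Definition is_anchor (s : option (option nat)) := if s is Some (Some _) then true else false.

Definition wall_apart (a b : int) : bool := (a + 2 <= b) || (b + 2 <= a).

(** Boxes of radii [r] around 0 and [r'] around [e]. A wall is recorded by the lower coordinate of the edges that cross it: r and - r - 1 for the first box. Walls of the two boxes in a common direction are at distance at least 2, and distinct radii make the smallest box containing a site unique. *)
Definition compatible (e : Zd d) (r r' : nat) : bool :=
  (r != r') && [forall i,
   [&& wall_apart r%:Z (coord e i + r'%:Z),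
       wall_apart r%:Z (coord e i - r'%:Z - 1),
       wall_apart (- r%:Z - 1) (coord e i + r'%:Z) &
       wall_apart (- r%:Z - 1) (coord e i - r'%:Z - 1)]].

Lemma compatibleN e r r' : compatible e r r' -> compatible (- e) r' r.
Proof.
move=> /andP[rr /forallP h]; rewrite /compatible eq_sym rr/=; apply/forallP => i.
have := h i; rewrite /wall_apart coordN; lia.
Qed.

Definition far_list : seq (Zd d) := [seq e <- box_list d (5 * sep) | e != 0].

Lemma mem_far_list e : (e \in far_list) = (e != 0) && inbox (5 * sep) e.
Proof. by rewrite mem_filter mem_box_list. Qed.

Definition radius_ok (sigma : Zd d -> option (option nat)) (r : nat) : bool :=
  all (fun e => if sigma e is Some (Some r') then compatible e r r' else true) far_list.

(** A site [v] becomes an anchor unless an earlier anchor is within distance sep; its radius is the first one in [sep, 2 sep) that is compatible with the earlier anchors. *)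
Definition choose_anchor (sigma : Zd d -> option (option nat)) : option nat :=
  if has (fun e => is_anchor (sigma e)) (box_list d sep) then None
  else Some (head sep [seq r <- iota sep sep | radius_ok sigma r]).

(** The solutions r of |a - b| <= 1 where a is r or - r - 1 and b is one of the two walls of the other box in the same direction. *)
Definition bad_radii_along (c : int) (r' : nat) : seq int :=
  let b := c + r'%:Z in let b' := c - r'%:Z - 1 in
  [:: b - 1; b; b + 1; - b - 2; - b - 1; - b;
      b' - 1; b'; b' + 1; - b' - 2; - b' - 1; - b'].

Lemma bad_radii_alongP c r' (r : nat) : r%:Z \notin bad_radii_along c r' ->
   [&& wall_apart r%:Z (c + r'%:Z),
       wall_apart r%:Z (c - r'%:Z - 1),
       wall_apart (- r%:Z - 1) (c + r'%:Z) &
       wall_apart (- r%:Z - 1) (c - r'%:Z - 1)].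
Proof. by rewrite /bad_radii_along !inE /wall_apart; lia. Qed.

Definition bad_radii (e : Zd d) (r' : nat) : seq int :=
  r'%:Z :: flatten [seq bad_radii_along (coord e i) r' | i <- enum 'I_d].

Lemma size_bad_radii e r' : size (bad_radii e r') = (12 * d + 1)%N.
Proof.
rewrite /bad_radii /= addn1; congr _.+1.
transitivity (12 * size (enum 'I_d))%N; last by rewrite size_enum_ord.
elim: (enum 'I_d) => //= i s IH.
by rewrite IH mulnS.
Qed.

Lemma bad_radiiP e r r' : r%:Z \notin bad_radii e r' -> compatible e r r'.
Proof.
rewrite inE negb_or => /andP[rr h]; apply/andP; split; first by move: rr; rewrite eqz_nat.
apply/forallP => i; apply: bad_radii_alongP; apply: contra h => h.
by apply/flattenP; exists (bad_radii_along (coord e i) r') => //; apply: map_f; rewrite mem_enum.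
Qed.

Lemma sep_ge4 : (4 <= sep)%N. Proof. by rewrite /sep leq_addl. Qed.

Lemma sep_gt0 : (0 < sep)%N. Proof. exact: leq_trans sep_ge4. Qed.

Lemma sep_le5 : (sep <= 5 * sep)%N. Proof. by rewrite leq_pmull. Qed.

Definition cell (e : Zd d) : {ffun 'I_d -> 'I_11} :=
  [ffun i => inord (absz (coord e i + (5 * sep)%:Z) %/ sep)].

(** Two points in a cell of side sep differ by less than sep in each coordinate. *)
Lemma cell_inj e e' : inbox (5 * sep) e -> inbox (5 * sep) e' ->
  cell e = cell e' -> inbox sep (e - e').
Proof.
move=> /inbox_coordP he /inbox_coordP he' /ffunP h; apply/inbox_coordP => i.
rewrite coordB; have := h i; rewrite !ffunE => /(congr1 val).
have := he i; have := he' i; move: (coord e i) (coord e' i) => x y hy hx.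
have s0 := sep_gt0; move: sep s0 hx hy => s s0 hx hy.
have b1 : (absz (x + (5 * s)%:Z)%R %/ s < 11)%N by rewrite ltn_divLR//; lia.
have b2 : (absz (y + (5 * s)%:Z)%R %/ s < 11)%N by rewrite ltn_divLR//; lia.
rewrite /= !inordK// => hdiv.
have e1 := divn_eq (absz (x + (5 * s)%:Z)%R) s.
have e2 := divn_eq (absz (y + (5 * s)%:Z)%R) s.
have m1 := ltn_pmod (absz (x + (5 * s)%:Z)%R) s0.
have m2 := ltn_pmod (absz (y + (5 * s)%:Z)%R) s0.
rewrite hdiv in e1; move: e1 e2 m1 m2.
move: (_ %/ _ * s)%N => k.
move: (absz _ %% s)%N => m1; move: (absz _ %% s)%N => m2; lia.
Qed.

Lemma crowd_bound (L : seq (Zd d)) : uniq L ->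
  (forall e, e \in L -> inbox (5 * sep) e) ->
  (forall e e', e \in L -> e' \in L -> e != e' -> ~~ inbox sep (e - e')) ->
  (size L <= crowd)%N.
Proof.
move=> uL bL sL.
have : uniq (map cell L).
  rewrite map_inj_in_uniq// => e e' eL e'L h; apply/eqP; apply: contraT => ee'.
  by have := sL _ _ eL e'L ee'; rewrite (cell_inj (bL _ eL) (bL _ e'L) h).
move/card_uniqP; rewrite size_map => <-; apply: leq_trans (max_card _) _.
by rewrite card_ffun !card_ord.
Qed.

(** Separated anchors are at most [crowd] in number, so together they exclude fewer than sep radii. *)
Lemma good_radius_exists (sigma : Zd d -> option (option nat)) :
  (forall e e', e \in far_list -> e' \in far_list -> is_anchor (sigma e) ->
     is_anchor (sigma e') -> e != e' -> ~~ inbox sep (e - e')) ->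
  exists2 r, (sep <= r < sep + sep)%N & radius_ok sigma r.
Proof.
move=> hs; pose L := undup [seq e <- far_list | is_anchor (sigma e)].
have sL : (size L <= crowd)%N.
  apply: crowd_bound; first exact: undup_uniq.
    by move=> e; rewrite mem_undup mem_filter mem_far_list => /and3P[].
  by move=> e e'; rewrite !mem_undup [e \in _]mem_filter [e' \in _]mem_filter => /andP[a f] /andP[a' f']; exact: hs.
pose rad e : nat := if sigma e is Some (Some r') then r' else 0%N.
pose bad := flatten [seq bad_radii e (rad e) | e <- L].
have sbad : size bad = (size L * (12 * d + 1))%N.
  rewrite /bad; elim: L {sL bad} => // e s IH.
  by rewrite (size_cat (bad_radii e (rad e))) IH size_bad_radii mulSn.
have [r rs rb] : exists2 r, r \in iota sep sep & r%:Z \notin bad.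
  apply: contrapT => hn.
  have sub : {subset map Posz (iota sep sep) <= bad}.
    move=> z /mapP[r rs ->]; apply: contraT => rb; exfalso; apply: hn.
    by exists r.
  have um : uniq (map Posz (iota sep sep)).
    by rewrite map_inj_uniq ?iota_uniq// => a b [].
  have := uniq_leq_size um sub; rewrite size_map size_iota sbad leqNgt.
  have h : (crowd * (12 * d + 1) < sep)%N by rewrite /sep; move: (crowd * _)%N => n; lia.
  by rewrite (leq_ltn_trans (leq_mul sL (leqnn _)) h).
exists r; first by move: rs; rewrite mem_iota.
apply/allP => e ef; case E : (sigma e) => [[r'|]|] //.
apply: bad_radiiP; apply: contra rb => rb.
apply/flattenP; exists (bad_radii e r') => //.
apply/mapP; exists e; last by rewrite /rad E.
by rewrite mem_undup mem_filter E.
Qed.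

Lemma choose_anchorP sigma :
  (forall e e', e \in far_list -> e' \in far_list -> is_anchor (sigma e) ->
     is_anchor (sigma e') -> e != e' -> ~~ inbox sep (e - e')) ->
  forall r, choose_anchor sigma = Some r -> radius_ok sigma r.
Proof.
move=> hs r; rewrite /choose_anchor; case: ifP => // _ [<-].
have [r' rr ok] := good_radius_exists hs.
have : r' \in [seq r <- iota sep sep | radius_ok sigma r] by rewrite mem_filter ok mem_iota.
case E : [seq r <- iota sep sep | radius_ok sigma r] => [//|r0 s] _ /=.
have : r0 \in [seq r <- iota sep sep | radius_ok sigma r] by rewrite E mem_head.
by rewrite mem_filter => /andP[].
Qed.

Lemma choose_anchor_range sigma r : choose_anchor sigma = Some r ->
  (sep <= r < sep + sep)%N.
Proof.
rewrite /choose_anchor; case: ifP => // _ [<-].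
case E : [seq r <- iota sep sep | radius_ok sigma r] => [|r0 s] /=.
  by rewrite leqnn/= -[X in (X < _)%N]addn0 ltn_add2l sep_gt0.
have : r0 \in [seq r <- iota sep sep | radius_ok sigma r] by rewrite E mem_head.
by rewrite mem_filter mem_iota => /andP[_].
Qed.

Section greedy_anchors.
Variables (m : Zd d -> option nat) (tau : Zd d -> nat).
Hypothesis gm : greedy far_list choose_anchor m tau.

Lemma far_list_sym u v : u != v -> inbox (5 * sep) (u - v) ->
  (u - v \in far_list) /\ (v - u \in far_list).
Proof. by move=> uv h; rewrite !mem_far_list !subr_eq0 uv eq_sym uv/= h inboxB. Qed.

Lemma anchors_apart u v r r' : u != v -> inbox sep (u - v) ->
  m u = Some r -> m v = Some r' -> False.
Proof.
have key x y rx ry : x != y -> inbox sep (x - y) -> (tau x < tau y)%N ->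
    m x = Some rx -> m y = Some ry -> False.
  move=> xy bxy txy mx my.
  have [xyE _] := far_list_sym xy (inbox_le sep_le5 bxy).
  have [sigma mye sx] := greedy_sees gm xyE txy.
  move: my; rewrite mye /choose_anchor; case: ifP => // /negP + _; apply.
  by apply/hasP; exists (x - y); rewrite ?mem_box_list// sx mx.
move=> uv buv mu mv.
have [E1 E2] := far_list_sym uv (inbox_le sep_le5 buv).
have [t|t] := greedy_earlier gm E2 E1; first exact: key t mu mv.
by apply: key t mv mu; rewrite 1?eq_sym// inboxB.
Qed.

Lemma anchor_range u r : m u = Some r -> (sep <= r < sep + sep)%N.
Proof. by have [_ ->] := gm; exact: choose_anchor_range. Qed.

(** The later of the two anchors chose its radius in view of the other. The choice was possible because the anchors it saw are separated, by [anchors_apart]. *)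
Lemma anchors_compatible u v r r' : u != v -> inbox (5 * sep) (u - v) ->
  m u = Some r -> m v = Some r' -> compatible (u - v) r' r.
Proof.
have key x y rx ry : x - y \in far_list -> (tau x < tau y)%N ->
    m x = Some rx -> m y = Some ry -> compatible (x - y) ry rx.
  move=> xyE txy mx my; have [_ mE] := gm.
  rewrite mE in my; have := choose_anchorP _ my; rewrite /radius_ok.
  move=> /(_ _)/allP => h; have := h _ _ xyE; rewrite xyE addrC subrK txy mx; apply.
  move=> e e' eE e'E; rewrite eE e'E/=; case: ifP => // _; case: ifP => // _.
  case E1 : (m (y + e)) => [a|]//; case E2 : (m (y + e')) => [b|]// _ _ ee'.
  apply/negP => bee; apply: (anchors_apart _ _ E1 E2).
    by rewrite (inj_eq (addrI y)).
  by rewrite opprD addrACA subrr add0r.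
move=> uv buv mu mv.
have [E1 E2] := far_list_sym uv buv.
have [t|t] := greedy_earlier gm E2 E1; first exact: key t mu mv.
by rewrite -(opprB v u); apply: compatibleN; exact: key t mv mu.
Qed.

Lemma anchors_cover v : exists u r, m u = Some r /\ inbox sep (u - v).
Proof.
case mv : (m v) => [r|]; first by exists v, r; rewrite subrr inbox0.
have [_ mE] := gm; move: mv; rewrite mE /choose_anchor; case: ifP => // /hasP[e].
rewrite mem_box_list => be; case: ifP => // _.
by case E : (m (v + e)) => [r|]// _ _; exists (v + e), r; rewrite addrAC subrr add0r.
Qed.

End greedy_anchors.
End anchors.

(** * Four-coloring from the phases of boxes *)

Section box_coloring.
Variable d : nat.
Implicit Types (m : Zd d -> option nat) (u v w x y z : Zd d).

(** [u] is the center of the smallest box that contains [x]. *)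
Definition home m x u : Prop := exists r, [/\ m u = Some r, inbox r (x - u) &
  forall u' r', m u' = Some r' -> inbox r' (x - u') -> (r <= r')%N].

(** The color of [x] in a checkerboard centered at its home. *)
Definition phase m x : bool :=
  if pselect (exists u, home m x u) is left h then odd (norm1 (x - sval (cid h))) else false.

(** Adjacent sites that the phases fail to distinguish. *)
Definition clash m x y : Prop := norm1 (x - y) = 1%N /\ phase m x = phase m y.

Inductive component m x : Zd d -> Prop :=
| component_refl : component m x x
| component_step y z : component m x y -> clash m y z -> component m x z.

(** Inside a unit cube, a component touches one or two coordinates in direction [i]; this tells whether [x] has the larger of two. *)
Definition is_upper_end m x (i : 'I_d) : bool :=
  `[< exists2 z, component m x z & coord z i = coord x i - 1 >].

(** The parity of the position of [x] in the smallest cube that contains its component: a two-coloring of the component that depends on no choice of origin. *)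
Definition twist m x : bool := odd (\sum_(i < d) is_upper_end m x i).

Lemma norm1B x y : norm1 (x - y) = norm1 (y - x).
Proof. by apply: eq_bigr => i _; rewrite !mxE -abszN opprB. Qed.

Lemma clash_sym m x y : clash m x y -> clash m y x.
Proof.
by move=> [xy p]; split; rewrite // norm1B.
Qed.

Lemma component_trans m x y z : component m x y -> component m y z -> component m x z.
Proof. by move=> xy; elim => // y' z' _ xy' yz; exact: component_step yz. Qed.

Lemma component_sym m x y : component m x y -> component m y x.
Proof.
elim => [|y' z' _ IH yz]; first exact: component_refl.
apply: component_trans IH; apply: component_step (component_refl _ _) _.
exact: clash_sym.
Qed.

Lemma component_clash m x y z : clash m x y -> component m x z <-> component m y z.
Proof.
move=> xy; have cxy : component m x y by apply: component_step (component_refl _ _) xy.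
by split; apply: component_trans => //; exact: component_sym.
Qed.

Section valid.
Variable m : Zd d -> option nat.
Hypothesis m_range : forall u r, m u = Some r -> (sep d <= r < sep d + sep d)%N.
Hypothesis m_compat : forall u v r r', u != v -> inbox (5 * sep d) (u - v) ->
  m u = Some r -> m v = Some r' -> compatible (u - v) r' r.
Hypothesis m_cover : forall v, exists u r, m u = Some r /\ inbox (sep d) (u - v).

(** Two smallest boxes have equal radii, hence equal centers, as nearby anchors have distinct radii. *)
Lemma home_uniq x u u' : home m x u -> home m x u' -> u = u'.
Proof.
move=> [r [mu bu minr]] [r' [mu' bu' minr']].
have rr : r = r'.
  by apply/eqP; rewrite eqn_leq (minr _ _ mu' bu') (minr' _ _ mu bu).
apply/eqP; apply: contraT => uu'.
have /andP[_ h1] := m_range mu; have /andP[_ h2] := m_range mu'.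
have b : inbox (5 * sep d) (u - u').
  rewrite (_ : u - u' = (x - u') + (u - x)); last by rewrite [RHS]addrC addrA subrK.
  apply: inbox_le (inboxD bu' (_ : inbox r (u - x))); last by rewrite inboxB.
  by move: (sep d) h1 h2 => s; lia.
by have /andP[] := m_compat uu' b mu mu'; rewrite rr eqxx.
Qed.

Lemma home_exists x : exists u, home m x u.
Proof.
(* Some box contains x, as radii are at least the covering distance sep; take the smallest one. *)
pose Q r := `[< exists2 u, m u = Some r & inbox r (x - u) >].
have exQ : exists r, Q r.
  have [u [r [mu bu]]] := m_cover x; exists r; apply/asboolP; exists u => //.
  have /andP[h _] := m_range mu; apply: inbox_le h _; by rewrite inboxB.
case: (ex_minnP exQ) => r /asboolP[u mu bu] minr; exists u, r; split => //.
by move=> u' r' mu' bu'; apply: minr; apply/asboolP; exists u'.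
Qed.

Lemma phaseE x u : home m x u -> phase m x = odd (norm1 (x - u)).
Proof.
move=> hu; rewrite /phase; case: pselect => [h|[]]; last by exists u.
by case: cid => u' /= hu'; rewrite (home_uniq hu hu').
Qed.

(** If no box separates the two sites, they have the same home, and a unit step changes the parity of the distance to it. *)
Lemma clash_crosses x i : phase m x = phase m (x + unit_vec i) ->
  exists u r, [/\ m u = Some r, inbox (sep d + sep d) (x - u) &
    coord x i = coord u i + r%:Z \/ coord x i = coord u i - r%:Z - 1].
Proof.
move=> pxy; have [u [r [mu ne]]] : exists u r, m u = Some r /\
    inbox r (x - u) <> inbox r (x + unit_vec i - u).
  apply: contrapT => hn.
  have same u r : m u = Some r -> inbox r (x - u) = inbox r (x + unit_vec i - u).
    by move=> mu; apply: contrapT => h; apply: hn; exists u, r.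
  have [u hu] := home_exists x.
  have hu' : home m (x + unit_vec i) u.
    have [r [mu bu minr]] := hu; exists r; split => //; first by rewrite -same.
    by move=> u' r' mu'; rewrite -same//; exact: minr.
  move: pxy; rewrite (phaseE hu) (phaseE hu') addrAC odd_norm1D.
  by case: (odd _).
exists u, r; have /andP[h1 h2] := m_range mu.
have cE j : coord (x + unit_vec i - u) j = coord x j + (j == i)%:Z - coord u j.
  by rewrite coordB coordD coord_unit.
have ci : coord (x + unit_vec i - u) i = coord x i + 1 - coord u i by rewrite cE eqxx.
have cj j : j != i -> coord (x + unit_vec i - u) j = coord (x - u) j.
  by move=> ji; rewrite cE coordB (negbTE ji) addr0.
have [b|b] := boolP (inbox r (x - u)); have [b'|b'] := boolP (inbox r (x + unit_vec i - u)).
- by rewrite b b' in ne.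
- split => //; first by apply: inbox_le b; move: (sep d) h1 h2 => s; lia.
  left; apply: contrapT => h; move/negP: b'; apply; apply/inbox_coordP => j.
  have [->|ji] := eqVneq j i; last by rewrite cj//; exact/inbox_coordP.
  by have /inbox_coordP/(_ i) := b; rewrite ci coordB; lia.
- have hx : forall j, j != i -> - r%:Z <= coord (x - u) j <= r%:Z.
    by move=> j ji; rewrite -cj//; exact/inbox_coordP.
  have /inbox_coordP/(_ i) := b'; rewrite ci => hi.
  split => //.
    apply/inbox_coordP => j; have [->|ji] := eqVneq j i.
      by rewrite coordB; move: (sep d) h1 h2 => s; lia.
    by have := hx j ji; move: (sep d) h1 h2 => s; lia.
  right; apply: contrapT => h; move/negP: b; apply; apply/inbox_coordP => j.
  by have [->|ji] := eqVneq j i; [rewrite coordB; lia|exact: hx].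
- by rewrite (negbTE b) (negbTE b') in ne.
Qed.

Definition wall w (i : 'I_d) (a : int) : Prop := exists u r,
  [/\ m u = Some r, inbox (sep d + sep d + 2) (u - w) &
      a = coord u i + r%:Z \/ a = coord u i - r%:Z - 1].

(** The two walls belong to anchors close enough to be compatible, or to the same anchor, whose opposite walls are far apart. *)
Lemma wall_gap w i a b : wall w i a -> wall w i b -> a = b \/ wall_apart a b.
Proof.
move=> [u [r [mu bu ha]]] [v [r' [mv bv hb]]].
have s4 := sep_ge4 d.
have [uv|uv] := eqVneq u v.
  have rr : r = r' by move: mu; rewrite uv mv => -[].
  have /andP[h _] := m_range mu; rewrite uv in ha; rewrite rr in ha h.
  by rewrite /wall_apart; move: (sep d) s4 h => s; lia.
have b5 : inbox (5 * sep d) (u - v).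
  rewrite (_ : u - v = (u - w) + (w - v)); last by rewrite addrA subrK.
  apply: inbox_le (inboxD bu (_ : inbox (sep d + sep d + 2) (w - v))).
    by move: (sep d) s4 => s; lia.
  by rewrite inboxB.
have /andP[_ /forallP/(_ i)] := m_compat uv b5 mu mv.
by rewrite /wall_apart coordB; lia.
Qed.

(** Each step of a path inside a component crosses a wall. In each direction the path starts next to at most one wall, and reaching a second coordinate beyond it would take another wall at distance 1. *)
Lemma component_cube w x : component m w x -> forall i,
  [\/ coord x i = coord w i,
      coord x i = coord w i + 1 /\ wall w i (coord w i) |
      coord x i = coord w i - 1 /\ wall w i (coord w i - 1)].
Proof.
elim => [i|y z _ IH [yz pyz] i]; first by constructor 1.
have near t : t = y \/ t = z -> inbox 1 (t - y).
  by move=> [->|->]; rewrite ?subrr ?inbox0// inboxB; apply: inbox_norm1; rewrite yz.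
have by1 : inbox 1 (y - w).
  by apply/inbox_coordP => j; rewrite coordB; case: (IH j) => [|[]|[]] -> *; lia.
have {yz} [j [t [tyz hyz ptz]]] : exists j t, [/\ t = y \/ t = z,
    (t = y /\ z = t + unit_vec j) \/ (t = z /\ y = t + unit_vec j) &
    phase m t = phase m (t + unit_vec j)].
  have [j [h|h]] := norm1_eq1 yz.
    have yE : y = z + unit_vec j by rewrite -h addrC subrK.
    by exists j, z; split; [right|right|rewrite -yE pyz].
  have zE : z = y + unit_vec j by rewrite -(opprK (unit_vec j)) -h opprB addrC subrK.
  by exists j, y; split; [left|left|rewrite -zE pyz].
have [u [r [mu bu hu]]] := clash_crosses ptz.
have [->|ij] := eqVneq i j; last first.
  have -> : coord z i = coord y i; last exact: IH.
  by case: hyz => -[-> ->]; rewrite coordD coord_unit (negbTE ij) addr0.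
have btw : inbox 2 (t - w).
  rewrite (_ : t - w = (t - y) + (y - w)); last by rewrite addrA subrK.
  exact: (@inboxD _ 1 1 _ _ (near _ tyz) by1).
have wt : wall w j (coord t j).
  exists u, r; split => //.
  rewrite (_ : u - w = (u - t) + (t - w)); last by rewrite addrA subrK.
  by apply: inboxD btw; rewrite inboxB.
case: hyz => -[et eyz]; subst.
  rewrite coordD coord_unit eqxx; case: (IH j) => [e|[e we]|[e we]].
  - by constructor 2; rewrite -e.
  - exfalso; rewrite e in wt; have := wall_gap wt we; rewrite /wall_apart.
    by move: (coord w j) => c; case=> [|h]; lia.
  - by constructor 1; rewrite e subrK.
have ez : coord z j = coord (z + unit_vec j) j - 1.
  by rewrite coordD coord_unit eqxx addrK.
rewrite ez; case: (IH j) => [e|[e we]|[e we]].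
- by constructor 3; rewrite e; split => //; rewrite -e -ez.
- by constructor 1; rewrite e addrK.
- exfalso; rewrite ez e in wt; have := wall_gap wt we; rewrite /wall_apart.
  by move: (coord w j) => c; case=> [|h]; lia.
Qed.

Lemma component_inbox w x : component m w x -> inbox 1 (x - w).
Proof.
move=> /component_cube h; apply/inbox_coordP => j; rewrite coordB.
by case: (h j) => [e|[e _]|[e _]]; rewrite e; move: (coord w j) => c; lia.
Qed.

(** A step in direction [i] inside a component exchanges its two coordinates in that direction and keeps the others. *)
Lemma twist_up x i : clash m x (x + unit_vec i) -> twist m x != twist m (x + unit_vec i).
Proof.
move=> cl; set y := x + unit_vec i.
have cxy : component m x y by apply: component_step (component_refl _ _) cl.
rewrite /twist (bigD1 i)//= [in X in _ != X](bigD1 i)//=.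
have -> : is_upper_end m y i = true.
  apply/asboolP; exists x; first exact: component_sym.
  by rewrite /y coordD coord_unit eqxx addrK.
have -> : is_upper_end m x i = false.
  apply/negbTE/negP => /asboolP[z cz zE].
  have wx : wall x i (coord x i).
    have := component_cube cxy i; rewrite /y coordD coord_unit eqxx.
    by move: (coord x i) => c; case=> [|[_]|[]] => //; lia.
  have wx1 : wall x i (coord x i - 1).
    have := component_cube cz i; rewrite zE.
    by move: (coord x i) => c; case=> [|[]|[_]] => //; lia.
  have := wall_gap wx wx1; rewrite /wall_apart.
  by move: (coord x i) => c; case=> [|h]; lia.
rewrite (eq_bigr (fun j => nat_of_bool (is_upper_end m y j))); first by rewrite !oddD /=; case: (odd _).
move=> j ji; congr nat_of_bool; apply/asboolP/asboolP => -[z cz zE]; exists z.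
- exact/(component_clash _ cl).
- by rewrite zE /y coordD coord_unit (negbTE ji) addr0.
- exact/(component_clash _ cl).
- by rewrite zE /y coordD coord_unit (negbTE ji) addr0.
Qed.

Lemma twist_clash x y : clash m x y -> twist m x <> twist m y.
Proof.
move=> cl; have [xy _] := cl; have [i [h|h]] := norm1_eq1 xy.
  have xE : x = y + unit_vec i by rewrite -h addrC subrK.
  by have := @twist_up y i; rewrite -xE => /(_ (clash_sym cl))/eqP/nesym.
have yE : y = x + unit_vec i by rewrite -(opprK (unit_vec i)) -h opprB addrC subrK.
by have := @twist_up x i; rewrite -yE => /(_ cl)/eqP.
Qed.

Variables (m' : Zd d -> option nat) (u0 : Zd d).
Hypothesis m'_range : forall u r, m' u = Some r -> (r < sep d + sep d)%N.
Hypothesis mm' : forall x, inbox (2 * sep d + 2) x -> m' x = m (x + u0).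

Lemma box_near x u r : inbox 2 x -> (r < sep d + sep d)%N -> inbox r (x - u) ->
  inbox (2 * sep d + 2) u.
Proof.
move=> x2 rs b; rewrite (_ : u = (u - x) + x); last by rewrite subrK.
rewrite inboxB in b; apply: inbox_le (inboxD b x2).
by move: (sep d) rs => s; lia.
Qed.

(** Boxes have radius less than 2 sep, so a box that contains a site near the origin has its center in the window where [m'] copies [m]. *)
Lemma home_local x u : inbox 2 x -> home m (x + u0) (u + u0) -> home m' x u.
Proof.
move=> x2 [r [mu bu minr]].
have /andP[_ rs] := m_range mu.
have sub v : x + u0 - (v + u0) = x - v by rewrite opprD addrACA subrr addr0.
rewrite sub in bu; exists r; split => //.
  by rewrite mm' ?mu//; exact: (box_near x2 rs bu).
move=> u' r' mu' bu'; apply: (minr (u' + u0)); last by rewrite sub.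
by rewrite -mm' ?mu'//; exact: (box_near x2 (m'_range mu') bu').
Qed.

Lemma home_local_uniq x u v : inbox 2 x -> home m (x + u0) (u + u0) -> home m' x v -> u = v.
Proof.
move=> x2 hu [r [mv bv minr]]; have rs := m'_range mv.
have sub t : x + u0 - (t + u0) = x - t by rewrite opprD addrACA subrr addr0.
have [s [mu bu mins]] := hu; have /andP[_ ss] := m_range mu; rewrite sub in bu.
apply: (@addIr _ u0); apply: (home_uniq hu); exists r; split => //; last 2 first.
- by rewrite sub.
- move=> u' r' mu' bu'; have /andP[_ r's] := m_range mu'.
  have eu' : u' = u' - u0 + u0 by rewrite subrK.
  move: mu' bu'; rewrite eu' sub; move: (u' - u0) => t mt bt.
  apply: (minr t) => //.
  by rewrite mm' ?mt//; exact: (box_near x2 r's bt).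
by rewrite -mm' ?mv//; exact: (box_near x2 rs bv).
Qed.

Lemma phase_local x : inbox 2 x -> phase m' x = phase m (x + u0).
Proof.
move=> x2; have [u hu] := home_exists (x + u0); rewrite (phaseE hu).
have hu' : home m (x + u0) (u - u0 + u0) by rewrite subrK.
rewrite /phase; case: pselect => [h|[]]; last by exists (u - u0); exact: home_local.
case: cid => v /= hv; rewrite -(home_local_uniq x2 hu' hv).
by rewrite opprB addrA.
Qed.

Lemma clash_local x y : inbox 2 x -> inbox 2 y ->
  clash m' x y <-> clash m (x + u0) (y + u0).
Proof.
move=> x2 y2; rewrite /clash !phase_local// opprD addrACA subrr addr0.
by [].
Qed.

(** A component fits in a unit cube, so [m'] and [m] show the same one, step by step. *)
Lemma component_local z : component m' 0 z <-> component m u0 (z + u0).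
Proof.
have stepbox x y : inbox 1 x -> norm1 (x - y) = 1%N -> inbox 2 y.
  move=> bx xy; rewrite (_ : y = (y - x) + x); last by rewrite subrK.
  by apply: (@inboxD _ 1 1) bx; apply: inbox_norm1; rewrite norm1B xy.
split.
  elim => [|x y _ IH xy]; first by rewrite add0r; exact: component_refl.
  have bx := component_inbox IH; rewrite addrK in bx.
  apply: component_step IH _; apply/clash_local => //; first exact: inbox_le bx.
  by case: xy => + _; exact: stepbox.
move=> h; rewrite -[z](addrK u0); elim: h => [|x y cx IH xy].
  by rewrite subrr; exact: component_refl.
have bx := component_inbox cx.
apply: component_step IH _; apply/clash_local; rewrite ?subrK//.
  exact: inbox_le bx.
by case: xy => xy _; apply: stepbox bx _; rewrite opprB addrA subrK.
Qed.

Lemma twist_local : twist m' 0 = twist m u0.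
Proof.
rewrite /twist; congr odd; apply: eq_bigr => i _; congr nat_of_bool.
apply/asboolP/asboolP => -[z cz zE].
  exists (z + u0); first exact/component_local.
  by rewrite coordD zE /coord mxE add0r addrC.
exists (z - u0); first by apply/component_local; rewrite subrK.
by rewrite coordB zE /coord mxE add0r addrAC subrr add0r.
Qed.

End valid.
End box_coloring.

Section box_rule.
Variables (d q : nat).
Hypothesis q4 : (4 <= q.+1)%N.

(** Two bits, the phase and the twist. *)
Definition box_color (m : Zd d -> option nat) : 'I_q.+1 :=
  inord (2 * phase m 0 + twist m 0).

(** Adjacent sites with equal phases have different twists, and both are visible in the window. *)
Lemma local_rule_box : local_rule d q.+1.
Proof.
exists (option nat), (far_list d), (box_list d (2 * sep d + 2)), (@choose_anchor d), box_color.
split; first by rewrite mem_far_list eqxx.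
move=> m tau gm u v uv.
have mr := anchor_range gm; have mc := anchors_compatible gm; have mv := anchors_cover gm.
pose tr w := truncate (box_list d (2 * sep d + 2)) (@choose_anchor d (fun=> None)) (translate w m).
have tr_range w x r : tr w x = Some r -> (r < sep d + sep d)%N.
  rewrite /tr /truncate /translate; case: ifP => _.
    by move=> /mr/andP[].
  by move=> /choose_anchor_range/andP[].
have tr_loc w x : inbox (2 * sep d + 2) x -> tr w x = m (x + w).
  by rewrite /tr /truncate /translate mem_box_list => ->.
have ph w : phase (tr w) 0 = phase m w.
  by rewrite (phase_local mr mc mv (tr_range w) (tr_loc w) (inbox0 _ _)) add0r.
have tw w : twist (tr w) 0 = twist m w.
  exact: (twist_local mr mc mv (tr_range w) (tr_loc w)).
move=> /(congr1 val); rewrite /box_color -!/(tr _) !ph !tw /= !inordK; last 2 first.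
- by apply: leq_trans q4; case: phase; case: twist.
- by apply: leq_trans q4; case: phase; case: twist.
move=> E; have {E} [ep et] : phase m u = phase m v /\ twist m u = twist m v.
  by move: E; case: (phase m u); case: (phase m v); case: (twist m u); case: (twist m v).
exact: (twist_clash mr mc mv (conj uv ep)).
Qed.

End box_rule.

Lemma local_rule_exists d q : (d = 1 /\ 3 <= q)%N \/ (2 <= d /\ 4 <= q)%N -> local_rule d q.
Proof.
case: q => [|q]; first by move=> [[]|[]].
by move=> [[-> q3]|[_ q4]]; [exact: local_rule_line|exact: local_rule_box].
Qed.

(** * Binary digits of a uniform random variable *)

Section fair_bits.
Variable R : realType.
Local Notation U := (uniform_prob (@ltr01 R)).

Lemma uniform_itv (a b : R) : 0 <= a -> a <= b -> b <= 1 -> U `[a, b[%classic = (b - a)%:E.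
Proof.
move=> a0 ab b1; rewrite /uniform_prob integral_uniform_pdf.
have -> : `[a, b[%classic `&` `[0, 1]%classic = `[a, b[%classic :> set R.
  apply/setIidPl => x /=; rewrite !in_itv/= => /andP[ax xb].
  by rewrite (le_trans a0 ax) (ltW (lt_le_trans xb b1)).
rewrite (eq_integral (fun=> 1%:E)).
  rewrite integral_cst//= mul1e lebesgue_measure_itv/= lte_fin.
  by case: ltP => // ba; have -> : a = b; [apply/eqP; rewrite eq_le ab|rewrite subrr].
move=> x; rewrite inE/= in_itv/= => /andP[ax xb].
rewrite /uniform_pdf (le_trans a0 ax) (ltW (lt_le_trans xb b1)).
by rewrite subr0 invr1.
Qed.

Definition digit (n : nat) (x : R) : bool := odd (Num.truncn (2 ^+ n.+1 * x)).

(** The integer with binary digits eps 0, ..., eps (n - 1), most significant first. *)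
Fixpoint prefix (eps : nat -> bool) (n : nat) : nat :=
  if n is n'.+1 then (2 * prefix eps n' + eps n')%N else 0%N.

Lemma prefix_lt eps n : (prefix eps n < 2 ^ n)%N.
Proof. by elim: n => //= n IH; rewrite expnS; case: (eps n); lia. Qed.

Lemma truncn_double (x : R) : 0 <= x -> (Num.truncn (2 * x))./2 = Num.truncn x.
Proof.
move=> x0; apply/esym/truncn_def; have := truncn_itv (mulr_ge0 (ler0n R 2) x0).
set t := Num.truncn (2 * x) => /andP[h1 h2].
have [k kE] : exists k, t = (2 * k)%N \/ t = (2 * k).+1.
  by exists t./2; have := odd_double_half t; case: (odd t); lia.
have -> : t./2 = k by case: kE => ->; lia.
by case: kE => kE; move: h1 h2; rewrite kE -!natr1 natrM; lra.
Qed.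

(** The first n digits amount to the integer part of 2^n x, one bit at a time. *)
Lemma digits_prefix eps n (x : R) : 0 <= x < 1 ->
  (forall i, (i < n)%N -> digit i x = eps i) <-> Num.truncn (2 ^+ n * x) = prefix eps n.
Proof.
move=> /andP[x0 x1]; elim: n => [|n IH] /=.
  by rewrite expr0 mul1r; split => // _; apply: truncn_def; rewrite x0.
have hd := truncn_double (mulr_ge0 (exprn_ge0 n (ler0n R 2)) x0).
rewrite mulrA -exprS in hd.
have ht := odd_double_half (Num.truncn (2 ^+ n.+1 * x)); rewrite hd -/(digit n x) in ht.
split=> [h|h].
  rewrite -ht (IH.1 (fun i hi => h i (ltnW hi))) (h n (ltnSn n)).
  by rewrite addnC mul2n.
have [e1 e2] : digit n x = eps n /\ Num.truncn (2 ^+ n * x) = prefix eps n.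
  move: ht; rewrite h; move: (Num.truncn _) (prefix _ _) => t p.
  by case: (digit n x); case: (eps n) => /= hh; try (by exfalso; lia); split => //; lia.
move=> i; rewrite ltnS leq_eqVlt => /orP[/eqP ->//|]; exact: IH.2.
Qed.

Lemma measurable_truncn_eq (c : R) k : 0 < c ->
  measurable [set x : measurableTypeR R | Num.truncn (c * x) = k].
Proof.
move=> c0; have mgt n : measurable [set x : measurableTypeR R | (n < Num.truncn (c * x))%N].
  have -> : [set x : measurableTypeR R | (n < Num.truncn (c * x))%N] = `[n.+1%:R / c, +oo[%classic.
    by apply/seteqP; split => x /=; rewrite in_itv/= andbT truncn_gt_nat ler_pdivrMr// mulrC.
  exact: measurable_itv.
case: k => [|k].
  have -> : [set x : measurableTypeR R | Num.truncn (c * x) = 0%N] =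
     ~` [set x : measurableTypeR R | (0 < Num.truncn (c * x))%N].
    by apply/seteqP; split => x /=; [move=> ->|move/negP; rewrite -leqNgt leqn0 => /eqP].
  exact: measurableC.
have -> : [set x : measurableTypeR R | Num.truncn (c * x) = k.+1] =
   [set x : measurableTypeR R | (k < Num.truncn (c * x))%N] `\`
   [set x : measurableTypeR R | (k.+1 < Num.truncn (c * x))%N].
  apply/seteqP; split => x /=; first by move=> ->; split => //; rewrite ltnn.
  by move=> [h1 /negP h2]; lia.
exact: measurableD.
Qed.

Lemma measurable_digit n b : measurable [set x : measurableTypeR R | digit n x = b].
Proof.
have -> : [set x : measurableTypeR R | digit n x = b] =
  \bigcup_(k in [set k | odd k = b]) [set x : measurableTypeR R | Num.truncn (2 ^+ n.+1 * x) = k].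
  apply/seteqP; split => x /=; first by move=> <-; exists (Num.truncn (2 ^+ n.+1 * x)).
  by move=> [k /= kb tk]; rewrite /digit tk.
by apply: bigcup_measurable => k _; apply: measurable_truncn_eq; rewrite exprn_gt0.
Qed.

Definition digit_event (N : nat) (D : pred nat) (eps : nat -> bool) : set (measurableTypeR R) :=
  [set x | forall i, (i < N)%N -> D i -> digit i x = eps i].

Lemma measurable_digit_event N D eps : measurable (digit_event N D eps).
Proof.
have -> : digit_event N D eps =
   \bigcap_(i in [set i | (i < N)%N && D i]) [set x : measurableTypeR R | digit i x = eps i].
  apply/seteqP; split => x /=; first by move=> h i /= /andP[iN Di]; apply: h.
  by move=> h i iN Di; apply: h; rewrite /= iN.
by apply: bigcap_measurableType => i _; exact: measurable_digit.
Qed.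

(** The digits behave as expected on [0, 1) only, and the point 1 is negligible. *)
Lemma uniform_unit (A : set (measurableTypeR R)) : measurable A ->
  U A = U (A `&` `[0, 1[%classic).
Proof.
move=> mA; have mI : measurable (`[0, 1[%classic : set (measurableTypeR R)).
  exact: measurable_itv.
have UI : U (~` `[0, 1[%classic) = 0%E.
  by rewrite [LHS]probability_setC// [X in (_ - X)%E]uniform_itv// subr0 subee.
rewrite {1}(_ : A = (A `&` `[0, 1[%classic) `|` (A `\` `[0, 1[%classic)); last by rewrite setUIDK.
rewrite [LHS]measureU//; first last.
- by rewrite setDE setIACA setICr setI0.
- exact: measurableD.
- exact: measurableI.
rewrite [X in (_ + X)%E](_ : _ = 0%E) ?adde0//.
apply/eqP; rewrite -measure_le0 -UI; apply: le_measure; rewrite ?inE//.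
- exact: measurableD.
- exact: measurableC.
Qed.

Lemma digit_event_full N eps : U (digit_event N predT eps) = ((2^-1) ^+ N)%:E.
Proof.
rewrite uniform_unit; last exact: measurable_digit_event.
have p0 : 0 < 2 ^+ N :> R by rewrite exprn_gt0.
have pl : (prefix eps N).+1%:R <= 2 ^+ N :> R by rewrite -natrX ler_nat prefix_lt.
have -> : digit_event N predT eps `&` `[0, 1[%classic =
   `[(prefix eps N)%:R / 2 ^+ N, (prefix eps N).+1%:R / 2 ^+ N[%classic.
  apply/seteqP; split => x /=; rewrite !in_itv/= ler_pdivrMr// ltr_pdivlMr// mulrC.
    move=> [h x01]; have /(digits_prefix _ _ x01) <- : forall i, (i < N)%N -> digit i x = eps i.
      by move=> i iN; exact: h.
    by apply: truncn_itv; rewrite mulr_ge0 ?exprn_ge0//; case/andP: x01.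
  move=> h; have x01 : 0 <= x < 1.
    case/andP: h => h1 h2; apply/andP; split.
      by rewrite -(pmulr_rge0 _ p0); apply: le_trans h1.
    by rewrite -(ltr_pM2l p0) mulr1; apply: lt_le_trans pl.
  split => // i iN _; apply: (digits_prefix eps N x01).2 => //.
  exact: truncn_def.
rewrite uniform_itv.
- by rewrite -mulrBl -natrB// subSnn mul1r exprVn.
- by rewrite divr_ge0// ltW.
- by rewrite ler_pM2r ?invr_gt0// ler_nat.
- by rewrite ler_pdivrMr// mul1r.
Qed.

(** Induction on the number of unconstrained digits below N: splitting on such a digit gives two events with one more constraint, each of half the probability. *)
Lemma digit_event_prob N (D : pred nat) eps :
  U (digit_event N D eps) = ((2^-1) ^+ count D (iota 0 N))%:E.
Proof.
have [k] := ubnP (count (predC D) (iota 0 N)); elim: k D eps => // k IH D eps.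
rewrite ltnS => Dk; have [/allP h|] := boolP (all D (iota 0 N)).
  have -> : digit_event N D eps = digit_event N predT eps.
    apply/seteqP; split => x h' i iN _; apply: h' => //.
    by apply: h; rewrite mem_iota.
  rewrite digit_event_full; congr ((_ ^+ _)%:E).
  by apply/esym; rewrite -[RHS](size_iota 0); apply/eqP; rewrite -all_count; exact/allP.
move=> /allPn[i0 i0N Di0]; pose D' := predU1 i0 D.
have hc : count D' (iota 0 N) = (count D (iota 0 N)).+1.
  have := count_predUI (pred1 i0) D (iota 0 N).
  rewrite (count_uniq_mem _ (iota_uniq 0 N)) i0N (@eq_count _ (predI _ _) pred0) ?count_pred0.
    by rewrite addn0 add1n => <-; apply: eq_count => x; rewrite /D' /= .
  by move=> x /=; case: eqP => // ->; rewrite (negbTE Di0).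
have hc' : (count (predC D') (iota 0 N) < k)%N.
  have h1 := count_predC D (iota 0 N); have h2 := count_predC D' (iota 0 N).
  rewrite hc in h2; move: h1 h2 Dk.
  move: (count (predC D) _) (count (predC D') _) (count D _) (size _) => a b c n; lia.
pose e b i := if i == i0 then b else eps i.
have -> : digit_event N D eps = digit_event N D' (e true) `|` digit_event N D' (e false).
  apply/seteqP; split => x /=.
    move=> h; have [dx|dx] := boolP (digit i0 x); [left|right] => i iN;
      rewrite /D' /e /=; case: eqP => [-> _|_ /= Di]; rewrite ?dx ?(negbTE dx)//; exact: h.
  have ne i : D i -> (i == i0) = false by move=> Di; apply/eqP => ii; rewrite -ii Di in Di0.
  by move=> [h|h] i iN Di; rewrite (h i iN) /e ?ne//= /D' /= Di orbT.
rewrite [LHS]measureU; try exact: measurable_digit_event.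
  rewrite [X in (X + _)%E]IH// [X in (_ + X)%E]IH// hc -EFinD exprS; congr (_%:E); lra.
rewrite -subset0 => x /= [h1 h2]; have := h1 i0; have := h2 i0.
rewrite mem_iota /= in i0N; rewrite /e eqxx /D' /= eqxx => /(_ i0N isT) -> /(_ i0N isT).
by [].
Qed.

Lemma digits_prob (L : seq nat) (eps : nat -> bool) : uniq L ->
  measurable [set x : measurableTypeR R | forall i, i \in L -> digit i x = eps i] /\
  U [set x | forall i, i \in L -> digit i x = eps i] = ((2^-1) ^+ size L)%:E.
Proof.
move=> uL; pose N := (\max_(i <- L) i).+1.
have LN i : i \in L -> (i < N)%N by move=> iL; rewrite ltnS; apply: leq_bigmax_seq.
have -> : [set x | forall i, i \in L -> digit i x = eps i] = digit_event N (mem L) eps.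
  by apply/seteqP; split => x /= h i; [move=> _; exact: h|move=> iL; apply: h => //; exact: LN].
split; first exact: measurable_digit_event.
rewrite digit_event_prob; congr ((_ ^+ _)%:E); rewrite -size_filter.
apply: perm_size; apply: uniq_perm => //; first by rewrite filter_uniq// iota_uniq.
by move=> i; rewrite mem_filter mem_iota /=; case: (boolP (i \in L)) => // /LN ->.
Qed.

End fair_bits.

(** * Bit sequences attached to the sites *)

Definition cylinder (n : nat) (eps : nat -> bool) : set (nat -> bool) :=
  [set s | forall j, (j < n)%N -> s j = eps j].

(** A pi-system; the empty set is the intersection of incompatible cylinders. *)
Definition bit_cylinders : set (set (nat -> bool)) :=
  [set C | C = set0 \/ exists n eps, C = cylinder n eps].

Definition bitseq := g_sigma_algebraType bit_cylinders.
HB.instance Definition _ := Measurable.on bitseq.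

Lemma bit_cylinders_setI : setI_closed bit_cylinders.
Proof.
move=> A B [->|[n [e ->]]]; first by rewrite set0I; left.
move=> [->|[n' [e' ->]]]; first by rewrite setI0; left.
have [[s [sn sn']]|h] := pselect (exists s, cylinder n e s /\ cylinder n' e' s); last first.
  by left; rewrite -subset0 => s [s1 s2]; apply: h; exists s.
right; exists (maxn n n'), s; apply/seteqP; split => t /=.
  by move=> [tn tn'] j; rewrite leq_max => /orP[jn|jn]; [rewrite sn// tn|rewrite sn'// tn'].
move=> h; split => j jn; rewrite h ?leq_max ?jn ?orbT//; [exact: sn|exact: sn'].
Qed.

Lemma measurable_cylinder n eps : measurable (cylinder n eps : set bitseq).
Proof. by apply: sub_sigma_algebra; right; exists n, eps. Qed.

Lemma measurable_bit j : simple_measurable (fun s : bitseq => s j).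
Proof.
move=> b; pose ext (f : {ffun 'I_j.+1 -> bool}) : nat -> bool := fun i => f (inord i).
have -> : (fun s : bitseq => s j) @^-1` [set b] =
   \bigcup_(f in [set f : {ffun 'I_j.+1 -> bool} | f ord_max = b]) (cylinder j.+1 (ext f)).
  apply/seteqP; split => s /=.
    move=> sb; exists [ffun i : 'I_j.+1 => s i]; first by rewrite /= ffunE.
    by move=> i ij; rewrite /ext ffunE inordK.
  move=> [f /= fb]; move=> /(_ j (ltnSn j)) ->; rewrite /ext -fb; congr (f _).
  by apply: val_inj; rewrite /= inordK.
apply: fin_bigcup_measurable; first exact: finite_finset.
by move=> f _; exact: measurable_cylinder.
Qed.

Section bit_labels.
Variables (R : realType) (d : nat).
Local Notation Om := (measurableTypeR R).
Local Notation U := (uniform_prob (@ltr01 R)).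

(** An injection of site-bit pairs into the positions of binary digits: each site receives its own infinite subsequence of the digits of one uniform number. *)
Definition bit_index (v : Zd d) (j : nat) : nat := @choice.pickle (Zd d * nat)%type (v, j).

Lemma bit_indexK v j : @choice.unpickle (Zd d * nat)%type (bit_index v j) = Some (v, j).
Proof. exact: choice.pickleK. Qed.

Definition bit_labels (w : Om) : labelings d bitseq :=
  fun v j => digit (bit_index v j) w.

Lemma measurable_bit_labels : measurable_fun setT bit_labels.
Proof.
apply: measurable_to_labelings => v.
apply: (@measurability _ _ Om bitseq setT _ bit_cylinders) => //.
move=> _ [_ [->|[n [eps ->]]] <-]; rewrite setTI; first by rewrite preimage_set0.
have -> : (fun w => bit_labels w v) @^-1` cylinder n eps =
  \bigcap_(j in [set j | (j < n)%N]) [set w : Om | digit (bit_index v j) w = eps j].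
  by apply/seteqP; split => w /= h j; exact: h.
by apply: bigcap_measurableType => j _; exact: measurable_digit.
Qed.

Definition bit_RV : {RV U >-> labelings d bitseq} := mfun_Sub (mem_set measurable_bit_labels).

(** The constrained digits have pairwise distinct positions, and there are as many as the total length of the cylinders. *)
Lemma bits_prob (V : seq (Zd d)) (n : Zd d -> nat) (eps : Zd d -> nat -> bool) : uniq V ->
  U [set w | forall v, v \in V -> cylinder (n v) (eps v) (bit_labels w v)] =
  (\prod_(v <- V) ((2^-1) ^+ n v)%:E)%E.
Proof.
move=> uV.
pose L := [seq bit_index v j | v <- V, j <- iota 0 (n v)].
pose e k := if @choice.unpickle (Zd d * nat)%type k is Some (v, j) then eps v j else false.
have uL : uniq L.
  apply: allpairs_uniq_dep => //; first by move=> v _; exact: iota_uniq.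
  move=> [v j] [v' j'] _ _ /= /(congr1 (@choice.unpickle (Zd d * nat)%type)).
  by rewrite !bit_indexK => -[-> ->].
have [_] := digits_prob R e uL.
rewrite (_ : [set x | _] = [set w | forall v, v \in V -> cylinder (n v) (eps v) (bit_labels w v)]).
  move=> ->; rewrite size_allpairs_dep sumnE big_map prodEFin; congr EFin.
  by rewrite prodrXr; congr (_ ^+ _); apply: eq_bigr => v _; rewrite size_iota.
apply/seteqP; split => w /= h.
  move=> v vV j jn; rewrite /bit_labels h; first by rewrite /e bit_indexK.
  by apply/allpairsPdep; exists v, j; rewrite mem_iota.
move=> i /allpairsPdep[v [j [vV]]]; rewrite mem_iota /= => jn ->.
by rewrite /e bit_indexK; exact: h.
Qed.

End bit_labels.

(** * Independence of the bit sequences *)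

Section bit_iid.
Variables (R : realType) (d : nat).
Local Notation Om := (measurableTypeR R).
Local Notation U := (uniform_prob (@ltr01 R)).
Local Notation lab := (@bit_labels R d).

Lemma bit_cylindersT : bit_cylinders setT.
Proof. by right; exists 0%N, (fun=> false); apply/seteqP; split. Qed.

Lemma bit_cylinders_measurable (C : set bitseq) : bit_cylinders C -> measurable C.
Proof. by move=> h; exact: sub_sigma_algebra. Qed.

Lemma eq_measure_bitseq (m1 m2 : {measure set bitseq -> \bar R}) :
  (m1 setT < +oo)%E -> (forall C, bit_cylinders C -> m1 C = m2 C) ->
  forall C, measurable C -> m1 C = m2 C.
Proof.
move=> m1T m12 C mC.
apply: (@measure_unique _ R bitseq bit_cylinders (fun=> setT)) => //.
- exact: bit_cylinders_setI.
- by move=> _; exact: bit_cylindersT.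
- by rewrite bigcup_const.
Qed.

Lemma measurable_bit_label v : @measurable_fun _ _ Om bitseq setT (fun w => lab w v).
Proof.
exact: measurableT_comp (@measurable_label d _ bitseq v) (@measurable_bit_labels R d).
Qed.

Lemma measurable_bit_label_event v (C : set bitseq) : measurable C ->
  measurable [set w : Om | C (lab w v)].
Proof.
by move=> mC; rewrite -[X in measurable X]setTI; exact: measurable_bit_label.
Qed.

Lemma measurable_bit_event (V : seq (Zd d)) (B : Zd d -> set bitseq) :
  (forall v, measurable (B v)) -> measurable [set w : Om | forall v, v \in V -> B v (lab w v)].
Proof.
move=> mB.
have -> : [set w : Om | forall v, v \in V -> B v (lab w v)] =
    \bigcap_(v in [set` V]) [set w : Om | B v (lab w v)].
  by apply/seteqP; split => w h v; apply: h.
apply: fin_bigcap_measurable; first exact: finite_seq.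
by move=> v _; exact: measurable_bit_label_event.
Qed.

Lemma cylinder_label_prob v n eps :
  U [set w | cylinder n eps (lab w v)] = ((2^-1) ^+ n)%:E.
Proof.
have := @bits_prob R d [:: v] (fun=> n) (fun=> eps) isT.
rewrite big_seq1 => <-; congr (U _); apply/seteqP; split => w /=.
  by move=> h u; rewrite inE => /eqP ->.
by apply; rewrite mem_head.
Qed.

Lemma bit_indep_cylinders (V : seq (Zd d)) (B : Zd d -> set bitseq) : uniq V ->
  (forall v, bit_cylinders (B v)) ->
  U [set w | forall v, v \in V -> B v (lab w v)] =
  (\prod_(v <- V) U [set w | B v (lab w v)])%E.
Proof.
move=> uV cB; have [[v0 v0V B0]|h] := pselect (exists2 v, v \in V & B v = set0).
  rewrite (_ : [set w | _] = set0); last first.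
    by rewrite -subset0 => w /= /(_ v0 v0V); rewrite B0.
  rewrite measure0 (perm_big _ (perm_to_rem v0V)) big_cons.
  have -> : [set w : Om | B v0 (lab w v0)] = set0 by rewrite B0.
  by rewrite /= [X in (X * _)%E]measure0 mul0e.
have hx v : exists p : nat * (nat -> bool), v \in V -> B v = cylinder p.1 p.2.
  case: (cB v) => [Bv|[n [e Bv]]]; last by exists (n, e).
  by exists (0%N, fun=> false) => vV; exfalso; apply: h; exists v.
have [p hp] := choice hx.
have := @bits_prob R d V (fun v => (p v).1) (fun v => (p v).2) uV.
rewrite (_ : [set w | _] = [set w | forall v, v \in V -> B v (lab w v)]); last first.
  apply/seteqP; split => w /= hw v vV; have := hw v vV; by rewrite hp.
move=> ->; rewrite big_seq [RHS]big_seq; apply: eq_bigr => v vV.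
by rewrite hp// cylinder_label_prob.
Qed.

(** Induction on the sites whose events may be arbitrary. As functions of the event at one such site, both sides are finite measures that agree on cylinders by the induction hypothesis. *)
Lemma bit_indep_aux (L : seq (Zd d)) (V : seq (Zd d)) (B : Zd d -> set bitseq) :
  uniq V -> (forall v, measurable (B v)) ->
  (forall v, v \notin L -> bit_cylinders (B v)) ->
  U [set w | forall v, v \in V -> B v (lab w v)] =
  (\prod_(v <- V) U [set w | B v (lab w v)])%E.
Proof.
elim: L V B => [|v0 L IH] V B uV mB cB; first by apply: bit_indep_cylinders => // v; exact: cB.
pose B' C v := if v == v0 then C else B v.
have mB' C : measurable C -> forall v, measurable (B' C v).
  by move=> mC v; rewrite /B'; case: ifP.
have cB' C : bit_cylinders C -> forall v, v \notin L -> bit_cylinders (B' C v).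
  by move=> cC v vL; rewrite /B'; case: ifPn => // vv0; apply: cB; rewrite inE negb_or vv0.
have [v0V|v0V] := boolP (v0 \in V); last first.
  have BE v : v \in V -> B v = B' setT v.
    by rewrite /B' => vV; case: eqP => // vv0; rewrite -vv0 vV in v0V.
  have := IH V (B' setT) uV (mB' _ (@measurableT _ _)) (cB' _ bit_cylindersT).
  rewrite big_seq (_ : [set w | _] = [set w | forall v, v \in V -> B v (lab w v)]); last first.
    by apply/seteqP; split => w /= h v vV; have := h v vV; rewrite BE.
  by move=> ->; rewrite [RHS]big_seq; apply: eq_bigr => v vV; rewrite BE.
pose V' := rem v0 V.
have v0V' : v0 \notin V' by rewrite mem_rem_uniqF.
have VE v : (v \in V) = (v == v0) || (v \in V').
  by rewrite (perm_mem (perm_to_rem v0V)) inE.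
pose A := [set w | forall v, v \in V' -> B v (lab w v)].
have mA : measurable (A : set Om) by exact: measurable_bit_event.
pose c := (\prod_(v <- V') U [set w | B v (lab w v)])%E.
have prodE C : (\prod_(v <- V) U [set w | B' C v (lab w v)])%E =
     (U [set w | C (lab w v0)] * c)%E.
  rewrite (perm_big _ (perm_to_rem v0V)) big_cons /= /B' eqxx; congr (_ * _)%E.
  rewrite /c big_seq [RHS]big_seq; apply: eq_bigr => v vV'.
  by case: eqP => // vv0; rewrite -vv0 vV' in v0V'.
have setE C : [set w | forall v, v \in V -> B' C v (lab w v)] =
    [set w | C (lab w v0)] `&` A.
  apply/seteqP; split => w /=.
    move=> h; split; first by have := h v0 v0V; rewrite /B' eqxx.
    move=> v vV'; have := h v; rewrite VE vV' orbT => /(_ isT); rewrite /B'.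
    by case: eqP => // vv0; rewrite -vv0 vV' in v0V'.
  move=> [h1 h2] v; rewrite VE /B'; case: eqP => [->//|_ /=]; exact: h2.
have key C : bit_cylinders C ->
    U ([set w | C (lab w v0)] `&` A) = (U [set w | C (lab w v0)] * c)%E.
  move=> cC; rewrite -setE -prodE; apply: IH => //; last exact: cB'.
  by apply: mB'; exact: bit_cylinders_measurable.
have c0 : (0 <= c)%E by apply: prode_ge0.
have cE : c = U A.
  have := key _ bit_cylindersT; rewrite setTI => ->.
  by rewrite [X in (X * _)%E](_ : _ = 1%E) ?mul1e//; exact: probability_setT.
have cfin : c \is a fin_num by rewrite cE; exact: fin_num_measure.
pose m1 : {measure set bitseq -> \bar R} :=
  measure_function_pushforward__canonical__measure_function_Measure
    (mrestr U mA) (measurable_bit_label v0).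
pose m2 : {measure set bitseq -> \bar R} :=
  mscale (NngNum (fine_ge0 c0))
   (measure_function_pushforward__canonical__measure_function_Measure U (measurable_bit_label v0)).
have m2E C : m2 C = (U [set w | C (lab w v0)] * c)%E.
  transitivity ((fine c)%:E * U [set w | C (lab w v0)])%E; first by [].
  by rewrite fineK// muleC.
have m1E C : m1 C = U ([set w | C (lab w v0)] `&` A) by [].
have m12 : forall C, measurable C -> m1 C = m2 C.
  apply: eq_measure_bitseq.
    rewrite (_ : m1 setT = U ([set: Om] `&` A))//.
    by rewrite setTI -cE -ge0_fin_numE.
  by move=> C cC; rewrite m1E m2E; exact: key.
have := m12 _ (mB v0); rewrite m1E m2E.
have BE : B = B' (B v0) by apply/funext => v; rewrite /B'; case: eqP => [->|].
by move=> mE; rewrite BE setE prodE; exact: mE.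
Qed.

Lemma bit_iid : iid_family U (@bit_RV R d).
Proof.
split.
  move=> V B mB; pose B1 v := if v \in V then B v else setT.
  have BE v : v \in V -> B1 v = B v by rewrite /B1 => ->.
  have := @bit_indep_aux V V B1 (fset_uniq V).
  rewrite (_ : [set w | _] = [set w | forall v, v \in V -> B v (lab w v)]); last first.
    by apply/seteqP; split => w /= h v vV; have := h v vV; rewrite BE.
  move=> h; apply: etrans (h _ _) _.
  - by move=> v; rewrite /B1; case: ifP.
  - by move=> v /negbTE vV; rewrite /B1 vV; exact: bit_cylindersT.
  - by rewrite big_seq [RHS]big_seq; apply: eq_bigr => v vV; rewrite BE.
move=> u v B mB.
pose push x : {measure set bitseq -> \bar R} :=
  measure_function_pushforward__canonical__measure_function_Measure U (measurable_bit_label x).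
apply: (@eq_measure_bitseq (push u) (push v)) => //.
  by rewrite (_ : push u setT = U setT)// [X in (X < _)%E]probability_setT ltry.
have pushE x C : push x C = U [set w | C (lab w x)] by [].
move=> C; rewrite !pushE => -[->|[n [e ->]]]; first by rewrite !measure0.
by rewrite !cylinder_label_prob.
Qed.

(** Sum over the 2^m common values of the m bits, each of probability 2^-2m. *)
Lemma agree_prob u v m : u != v ->
  measurable [set w : Om | forall j, (j < m)%N -> lab w u j = lab w v j] /\
  (U [set w | forall j, (j < m)%N -> lab w u j = lab w v j] <= ((2^-1) ^+ m)%:E)%E.
Proof.
move=> uv.
pose ext (f : {ffun 'I_m -> bool}) : nat -> bool :=
  fun j => if insub j is Some i then f i else false.
pose A (f : {ffun 'I_m -> bool}) := [set w : Om | forall x, x \in [:: u; v] ->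
   cylinder m (ext f) (lab w x)].
have mA f : measurable (A f).
  by apply: (@measurable_bit_event [:: u; v] (fun=> cylinder m (ext f))) => _; exact: measurable_cylinder.
have uuv : uniq [:: u; v] by rewrite /= inE uv.
have PA f : f \in enum {ffun 'I_m -> bool} -> (U (A f) <= ((2^-1) ^+ m * (2^-1) ^+ m)%:E)%E.
  move=> _; have := @bits_prob R d [:: u; v] (fun=> m) (fun=> ext f) uuv.
  by rewrite big_cons big_seq1 -EFinM => <-.
have [m1 m2] := union_bound mA PA.
have -> : [set w : Om | forall j, (j < m)%N -> lab w u j = lab w v j] =
   [set w | exists2 f, f \in enum {ffun 'I_m -> bool} & A f w].
  apply/seteqP; split => w /=.
    move=> h; exists [ffun i : 'I_m => lab w u i]; first by rewrite mem_enum.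
    move=> x; rewrite !inE => /orP[/eqP ->|/eqP ->] j jm; rewrite /ext insubT ffunE//=.
    by rewrite h.
  by move=> [f _ h] j jm; rewrite (h u _ j jm) ?(h v _ j jm)// !inE eqxx ?orbT.
split => //; apply: le_trans m2 _; rewrite -cardE card_ffun card_bool card_ord.
rewrite lee_fin mulrA natrX -exprMn mulfV ?expr1n ?mul1r//.
Qed.

End bit_iid.

(** * Growth of the thresholds *)

(** Base 4 dominates the exponential and is the growth provided by [threshold], whose doubled values satisfy T -> 2^(T/2). *)
Definition tower4 (n : nat) : nat := iter n (expn 4) 1%N.

Lemma tower4_gt n : (n < tower4 n)%N.
Proof. by elim: n => //= n IH; apply: leq_ltn_trans (ltn_expl _ _). Qed.

Lemma expR1_le4 (R : realType) : expR 1 <= 4 :> R.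
Proof.
have h : expR (2^-1) <= 2 :> R.
  have := expR_ge1Dx (- (2^-1) : R); rewrite expRN => h.
  rewrite -[2 in leRHS]invrK -[expR _]invrK lef_pV2 ?posrE ?invr_gt0 ?expR_gt0//.
  by apply: le_trans h; lra.
have -> : expR 1 = expR (2^-1) * expR (2^-1) :> R by rewrite -expRD; congr expR; lra.
rewrite (_ : 4 = 2 * 2 :> R); last by lra.
by apply: ler_pM => //; rewrite expR_ge0.
Qed.

Lemma iter_expR_le_tower4 (R : realType) n : iter n (@expR R) 1 <= (tower4 n)%:R.
Proof.
elim: n => //= n IH; apply: (@le_trans _ _ (expR (tower4 n)%:R)); first by rewrite ler_expR.
rewrite -[X in expR X]mulr1 mulrC expRM_natr natrX.
by apply: lerXn2r; rewrite ?nnegrE ?expR_ge0 ?expR1_le4.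
Qed.

Lemma threshold_ge n : (2 * n + 4 <= threshold n.+1)%N.
Proof.
elim: n => // n IH; rewrite [threshold _]/= -/(threshold n.+1).
case: (threshold n.+1) IH => [|[|[|[|T]]]]; rewrite ?addnS// => IH.
have : (T < 2 ^ T)%N by exact: ltn_expl.
rewrite /= (_ : T.+3 = (T + 3)%N) ?expnD; last by rewrite addn3.
by rewrite (_ : 2 ^ 3 = 8)%N//; lia.
Qed.

(** Starting late enough, the thresholds dominate the tower with room for the linear factors of the union bound. *)
Lemma threshold_growth (c n0 n : nat) : n0 = c.+4 ->
  (2 * tower4 n + (c + n0 + n + 2) <= threshold (n0 + n))%N.
Proof.
move=> n0E; elim: n => [|n IH].
  by rewrite !addn0 n0E; apply: leq_trans (threshold_ge _); rewrite (_ : tower4 0 = 1)%N//; lia.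
rewrite (addnS n0 n) [threshold (n0 + n).+1]/= -/(threshold (n0 + n)).
set X := (c + n0 + n + 2)%N in IH.
have X5 : (5 <= X)%N by rewrite /X n0E; lia.
apply: (@leq_trans (2 ^ (2 * tower4 n + X).-1)%N); last by rewrite leq_exp2l//; lia.
rewrite (_ : (2 * tower4 n + X).-1 = 2 * tower4 n + X.-1)%N; last by lia.
rewrite expnD expnM (_ : 2 ^ 2 = 4)%N//.
rewrite [tower4 n.+1]/(4 ^ tower4 n)%N.
have p0 : (0 < 4 ^ tower4 n)%N by rewrite expn_gt0.
have h : (X + 3 <= 2 ^ X.-1)%N.
  have -> : X.-1 = (X - 5 + 4)%N by lia.
  by rewrite expnD (_ : 2 ^ 4 = 16)%N//; have := ltn_expl (X - 5) (isT : 1 < 2)%N; lia.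
rewrite (_ : c + n0 + n.+1 + 2 = X.+1)%N; last by rewrite /X; lia.
apply: leq_trans (leq_mul (leqnn _) h).
rewrite (_ : X + 3 = 2 + X.+1)%N; last by lia.
by rewrite mulnDr mulnC leq_add2l leq_pmull.
Qed.

Lemma threshold_tail (R : realType) (c n0 n : nat) : n0 = c.+4 ->
  (c * (n0 + n).+1)%:R * (2^-1) ^+ threshold (n0 + n) <= (tower4 n)%:R^-1 :> R.
Proof.
move=> n0E; have h := threshold_growth n n0E.
have t0 : (0 < tower4 n)%N by apply: leq_ltn_trans (tower4_gt n).
rewrite exprVn ler_pdivrMr ?exprn_gt0// -[leLHS]mul1r ler_pdivlMl ?ltr0n//.
rewrite mul1r -natrX -natrM ler_nat.
apply: (@leq_trans (2 ^ (2 * tower4 n + (c + n0 + n + 2)))%N); last by rewrite leq_exp2l.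
rewrite expnD; apply: leq_mul.
  by apply: leq_trans (ltnW (ltn_expl (tower4 n) (isT : 1 < 2)%N)) _; rewrite leq_exp2l//; lia.
rewrite -!addnA expnD; apply: leq_mul; first exact/ltnW/ltn_expl.
by apply: leq_trans (ltn_expl (n0 + n) (isT : 1 < 2)%N) _; rewrite leq_exp2l//; lia.
Qed.

(** * The finitary coloring and its coding radius *)

Section code_labels.
Variable d : nat.
Local Notation M := (labelings d bitseq).

(** The labels fed to the color reduction: codes of first differing bits along each direction. *)
Definition code_labels (y : M) : Zd d -> Zd d -> nat := fun u e => diff_code (y u) (y (u + e)).

Lemma simple_measurable_label_bit (v : Zd d) j : simple_measurable (fun y : M => (y v : nat -> bool) j).
Proof.
exact: (simple_measurable_comp (@measurable_label d _ bitseq v) (measurable_bit j)).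
Qed.

Lemma measurable_agree (u v : Zd d) m :
  measurable [set y : M | forall j, (j < m)%N -> y u j = y v j].
Proof.
have -> : [set y : M | forall j, (j < m)%N -> y u j = y v j] =
   \bigcap_(j in [set j | (j < m)%N]) [set y : M | y u j = y v j] by [].
apply: bigcap_measurableType => j _.
exact: (measurable_rel (fun a b : bool => a = b)
  (@simple_measurable_label_bit u j) (@simple_measurable_label_bit v j)).
Qed.

Lemma measurable_first_diff (u v : Zd d) p :
  measurable [set y : M | first_diff (y u) (y v) = p].
Proof.
have mS k : measurable [set y : M | first_diff (y u) (y v) = k.+1].
  have -> : [set y : M | first_diff (y u) (y v) = k.+1] =
     [set y : M | y u k.+1 <> y v k.+1] `&` [set y : M | forall j, (j < k.+1)%N -> y u j = y v j].
    apply/seteqP; split => y /=.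
      move=> fd; have ex : exists i, y u i != y v i.
        by move: fd; rewrite /first_diff; case: pselect.
      split; first by apply/eqP; have := first_diff_neq ex; rewrite fd.
      move=> j jk; apply/eqP; apply: contraT => /first_diff_le; rewrite fd leqNgt jk//.
    move=> [/eqP h1 h2]; apply/eqP; rewrite eqn_leq first_diff_le//= leqNgt; apply/negP => lt.
    have := first_diff_neq (ex_intro (fun i => y u i != y v i) _ h1).
    by rewrite h2 ?eqxx.
  apply: measurableI; last exact: measurable_agree.
  exact: (measurable_rel (fun a b : bool => a <> b)
    (@simple_measurable_label_bit u k.+1) (@simple_measurable_label_bit v k.+1)).
case: p => // .
have -> : [set y : M | first_diff (y u) (y v) = 0%N] =
   ~` \bigcup_k [set y : M | first_diff (y u) (y v) = k.+1].
  apply/seteqP; split => y /=; first by move=> h [k _ /=]; rewrite h.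
  case F : (first_diff (y u) (y v)) => [//|k] h.
  by exfalso; apply: h; exists k.
by apply: measurableC; apply: bigcupT_measurable.
Qed.

Lemma measurable_code_labels (u e : Zd d) c : measurable [set y : M | code_labels y u e = c].
Proof.
have -> : [set y : M | code_labels y u e = c] =
  \bigcup_p ([set y : M | first_diff (y u) (y (u + e)) = p] `&`
     [set y : M | (2 * p + (y u : nat -> bool) p)%N = c]).
  apply/seteqP; split => y /=.
    by move=> h; exists (first_diff (y u) (y (u + e))).
  by move=> [p _ [/= h1 h2]]; rewrite /code_labels /diff_code h1.
apply: bigcupT_measurable => p; apply: measurableI; first exact: measurable_first_diff.
exact: (measurable_rel (fun (b _ : bool) => (2 * p + b)%N = c)
  (@simple_measurable_label_bit u p) (@simple_measurable_label_bit u p)).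
Qed.

(** The fibers of [h] other than that of [c0] are countable unions of events that constrain finitely many codes. *)
Lemma measurable_locally_determined (C : Type) (h : M -> C) (c0 : C) :
  (forall y, h y <> c0 -> exists L : seq (Zd d * Zd d), forall y',
     (forall p, p \in L -> code_labels y' p.1 p.2 = code_labels y p.1 p.2) -> h y' = h y) ->
  forall B : set C, measurable (h @^-1` B).
Proof.
move=> hL.
pose sat (J : seq (Zd d * Zd d * nat)) := [set y : M | forall t, t \in J ->
   code_labels y t.1.1 t.1.2 = t.2].
have msat J : measurable (sat J).
  have -> : sat J = \bigcap_(t in [set` J]) [set y : M | code_labels y t.1.1 t.1.2 = t.2] by [].
  apply: fin_bigcap_measurable; first exact: finite_seq.
  by move=> t _; exact: measurable_code_labels.
have key (B : set C) : ~ B c0 -> measurable (h @^-1` B).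
  move=> Bc0.
  have -> : h @^-1` B = \bigcup_(J in [set J | sat J `<=` h @^-1` B]) sat J.
    apply/seteqP; split => y /=; last by move=> [J /= JB yJ]; exact: JB.
    move=> By; have [|L hy] := hL y; first by move=> hc; apply: Bc0; rewrite -hc.
    exists [seq (p, code_labels y p.1 p.2) | p <- L].
      move=> y' y'J; rewrite /= hy// => p pL.
      by apply: (y'J (p, code_labels y p.1 p.2)); apply: map_f.
    by move=> t /mapP[p pL ->].
  rewrite bigcup_mkcond; apply: countable_bigcupT_measurable.
    exact: countableP.
  by move=> J; case: ifP.
move=> B; have [Bc0|Bc0] := pselect (B c0); last exact: key.
rewrite -[B]setCK preimage_setC; apply: measurableC.
by apply: (key (~` B)); apply.
Qed.

End code_labels.

Section construction.
Variables (R : realType) (d q : nat) (A : Type) (E W : seq (Zd d)).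
Variables (choose : (Zd d -> option A) -> A) (Psi : (Zd d -> A) -> 'I_q).
Hypothesis E0 : 0 \notin E.
Local Notation M := (labelings d bitseq).
Local Notation Om := (measurableTypeR R).
Local Notation U := (uniform_prob (@ltr01 R)).
Local Notation Y := (@bit_RV R d).
Local Notation mu := (distribution U Y).
Local Notation a0 := (choose (fun=> None)).
Local Notation K := (palette_size E).

Definition stage (y : M) t v : option A := assigned E choose (code_labels y) t v.

(** The value of [v] if it ever has a turn. *)
Definition final (y : M) (v : Zd d) : option A :=
  if pselect (exists s, exists t, stage y t v = Some s) is left h then Some (sval (cid h)) else None.

Lemma finalE y t v s : stage y t v = Some s -> final y v = Some s.
Proof.
move=> h; rewrite /final; case: pselect => [h'|[]]; last by exists s, t.
case: cid => s' /= [t' h'']; case/orP: (leq_total t t') => tt.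
  by have := assigned_mono tt h; rewrite [LHS]h''.
by have := assigned_mono tt h''; rewrite [LHS]h.
Qed.

Lemma final_stage y v : final y v <> None -> exists t, stage y t v <> None.
Proof.
by rewrite /final; case: pselect => // -[s [t h]] _; exists t; rewrite h.
Qed.

Definition complete (y : M) : Prop := forall w, w \in W -> final y w <> None.

(** The color of the origin; it is arbitrary when some site of the window never has a turn. *)
Definition origin_color (y : M) : 'I_q :=
  if pselect (complete y) is left _ then
    Psi (truncate W a0 (fun v => odflt a0 (final y v)))
  else Psi (fun=> a0).

Definition coloring (y : M) : config d 'I_q := fun v => origin_color (translate v y).

Lemma coloring_equivariant : equivariant coloring.
Proof.
move=> u y; apply/funext => v; rewrite /coloring /translate /=; congr origin_color.
by apply/funext => w; rewrite addrA.
Qed.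

Lemma code_labels_translate (u : Zd d) (y : M) :
  code_labels (translate u y : M) = (fun w => code_labels y (w + u)).
Proof. by apply/funext => v; apply/funext => e; rewrite /code_labels /translate addrAC. Qed.

Lemma final_translate u (y : M) v : final (translate u y : M) v = final y (v + u).
Proof.
have st t : stage (translate u y : M) t v = stage y t (v + u).
  by rewrite /stage code_labels_translate assigned_translate.
case E1 : (final y (v + u)) => [s|].
  have [|t] := @final_stage y (v + u); first by rewrite E1.
  case E2 : (stage y t (v + u)) => [s'|//] _.
  by rewrite (finalE (t := t) (s := s')) ?st// -E1; rewrite (finalE E2).
case E2 : (final (translate u y : M) v) => [s|//].
have [|t] := @final_stage (translate u y : M) v; first by rewrite E2.
rewrite st; case E3 : (stage y t (v + u)) => [s'|//] _.
by rewrite (finalE E3) in E1.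
Qed.

Definition reachE : nat := \max_(e <- E) norm1 e.
Definition reachW : nat := \max_(w <- W) norm1 w.
(** Deciding the window by time [t] takes codes at distance up to reachW + 2 reachE t, and a code involves one further label. *)
Definition radius (t : nat) : nat := (reachW + 2 * reachE * t + reachE)%N.

Lemma reachEP e : e \in E -> (norm1 e <= reachE)%N.
Proof. by move=> eE; apply: leq_bigmax_seq. Qed.

Lemma reachWP w : w \in W -> (norm1 w <= reachW)%N.
Proof. by move=> wW; apply: leq_bigmax_seq. Qed.

(** The event that the window is decided by time [t], from which locality in the labels follows. *)
Definition ready t (y : M) : Prop := forall w, w \in W -> stage y t w <> None.

Lemma complete_ready y : complete y -> exists t, ready t y.
Proof.
rewrite /complete /ready => h.
suff : exists t, forall w, w \in W -> stage y t w <> None by [].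
elim: W h => [|w s IH] h; first by exists 0%N.
have [|t ht] := IH; first by move=> x xs; apply: h; rewrite inE xs orbT.
have [|t' ht'] := @final_stage y w; first by apply: h; rewrite mem_head.
exists (maxn t t') => x; rewrite inE => /orP[/eqP ->|xs].
  by case E1 : (stage y t' w) ht' => [a|//] _; rewrite [stage _ _ _](assigned_mono (leq_maxr t t') E1).
by have := ht x xs; case E1 : (stage y t x) => [a|//] _; rewrite [stage _ _ _](assigned_mono (leq_maxl t t') E1).
Qed.

Lemma origin_color_local t y y' : ready t y ->
  (forall u e, (norm1 u <= reachW + 2 * reachE * t)%N -> e \in E ->
     code_labels y' u e = code_labels y u e) ->
  origin_color y' = origin_color y.
Proof.
move=> rt hyy'.
have st w : w \in W -> stage y' t w = stage y t w.
  move=> wW; apply: (assigned_local choose reachEP).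
  move=> u uw e eE; apply: hyy' => //; rewrite (_ : u = (u - w) + w); last by rewrite subrK.
  by apply: leq_trans (norm1D _ _) _; have := reachWP wW; lia.
have fw w : w \in W -> exists s, final y w = Some s /\ final y' w = Some s.
  move=> wW; have := rt w wW; case E1 : (stage y t w) => [s|//] _.
  by exists s; split; [exact: finalE E1|apply: (finalE (t := t)); rewrite st].
rewrite /origin_color; case: pselect => [c|[]]; last first.
  by move=> w /fw[s [_ ->]].
case: pselect => [c'|[]]; last by move=> w /fw[s [-> _]].
congr Psi; apply/funext => v; rewrite /truncate; case: ifP => // vW.
by have [s [-> ->]] := fw v vW.
Qed.

Lemma ready_determined t y : ready t y -> determined coloring y (radius t).
Proof.
move=> rt y' yy'; rewrite /coloring.
have tr0 (z : M) : translate 0 z = z by apply/funext => v; rewrite /translate addr0.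
rewrite !tr0; apply: origin_color_local rt _ => u e hu eE.
rewrite /code_labels !yy'//; rewrite /radius; last by lia.
by apply: leq_trans (norm1D _ _) _; have := reachEP eE; lia.
Qed.

Lemma measurable_origin_color B : measurable (origin_color @^-1` B).
Proof.
apply: (@measurable_locally_determined d _ origin_color (Psi (fun=> a0))) => y hy.
have cy : complete y by move: hy; rewrite /origin_color; case: pselect.
have [t rt] := complete_ready cy.
exists [seq (u, e) | u <- box_list d (reachW + 2 * reachE * t), e <- E] => y' h.
apply: origin_color_local rt _ => u e hu eE.
apply: (h (u, e)); apply/allpairsP; exists (u, e) => /=; split => //.
by rewrite mem_box_list; exact: inbox_norm1.
Qed.

Lemma coloring_measurable : measurable_coloring coloring.
Proof.
suff : <<s cylinders d (@discrete_measurable 'I_q) >> `<=`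
    [set B | measurable (coloring @^-1` B)] by [].
apply: smallest_sub.
  split => /=.
  - by rewrite preimage_set0.
  - by move=> B mB; rewrite setTD preimage_setC; exact: measurableC.
  - by move=> B mB; rewrite preimage_bigcup; exact: bigcupT_measurable.
move=> _ [v _ [C _ <-]] /=; rewrite setTI.
have -> : coloring @^-1` [set x | C (x v)] = translate v @^-1` (origin_color @^-1` C) by [].
rewrite -[X in measurable X]setTI; apply: (@measurable_translate d _ bitseq v) => //.
exact: measurable_origin_color.
Qed.

Definition pairs (n : nat) : seq (Zd d * nat) := [seq (e, i) | e <- E, i <- iota 0 n.+1].

(** The labels of two sites that are consecutive on the line through [v] of direction [p.1], [p.2] steps from [v], agree on a whole stretch of bits. *)
Definition long_agreement n v (p : Zd d * nat) : set M :=
  [set y | forall j, (j < threshold n)%N -> y (v + p.1 *+ p.2) j = y (v + p.1 *+ p.2 + p.1) j].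

(** The event that [n] rounds do not suffice at [v]. *)
Definition bad v n : set M := [set y | exists2 p, p \in pairs n & long_agreement n v p y].

Lemma bad_prob v n : measurable (bad v n) /\
  (mu (bad v n) <= ((size E * n.+1)%:R * (2^-1) ^+ threshold n)%:E)%E.
Proof.
have mL p : measurable (long_agreement n v p) by exact: measurable_agree.
have pL p : p \in pairs n -> (mu (long_agreement n v p) <= ((2^-1) ^+ threshold n)%:E)%E.
  move=> /allpairsP[[e i] /= [eE _ ->]].
  have ne : v + e *+ i != v + e *+ i + e.
    rewrite -subr_eq0 opprD addNKr oppr_eq0; apply: contra E0 => /eqP <-//.
  by have [_] := agree_prob R (threshold n) ne.
have := union_bound mL pL; rewrite size_allpairs size_iota.
by [].
Qed.

Definition never : set M := [set y | exists v, forall n, bad v n y].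

(** It is contained in [bad v n] for every [n], and the probabilities of these events tend to 0. *)
Lemma bad_forever_prob0 v : mu (\bigcap_n bad v n) = 0%E.
Proof.
have mB n : measurable (bad v n) by have [] := bad_prob v n.
have mI : measurable (\bigcap_n bad v n) by apply: bigcapT_measurable.
have fin : mu (\bigcap_n bad v n) \is a fin_num by exact: fin_num_measure.
(* Along the shifted indices of [threshold_tail] the bound is the inverse of a tower, and a tower exceeds its height. *)
have le j : fine (mu (\bigcap_n bad v n)) <= j.+1%:R^-1.
  rewrite -lee_fin fineK//; pose n := ((size E).+4 + j)%N.
  apply: (@le_trans _ _ (mu (bad v n))).
    by apply: le_measure; rewrite ?inE// => y; apply.
  have [_] := bad_prob v n; move/le_trans; apply; rewrite lee_fin.
  apply: le_trans (threshold_tail R j (erefl (size E).+4)) _.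
  rewrite lef_pV2 ?posrE ?ltr0n//; last by apply: leq_ltn_trans (tower4_gt j).
  by rewrite ler_nat tower4_gt.
rewrite -(fineK fin); congr EFin; apply/eqP; rewrite eq_le fine_ge0// andbT leNgt.
apply/negP => x0; set x := fine _ in x0 le.
have := le (Num.truncn x^-1); rewrite leNgt => /negP; apply.
rewrite -[ltRHS]invrK ltf_pV2 ?posrE ?invr_gt0 ?ltr0n//; exact: truncnS_gt.
Qed.

Lemma never_negligible : mu.-negligible never.
Proof.
pose F k := if @choice.unpickle (Zd d) k is Some v then \bigcap_n bad v n else set0.
apply: (@negligibleS _ _ _ mu (\bigcup_k F k)).
  move=> y [v hv]; exists (@choice.pickle (Zd d) v) => //.
  by rewrite /F choice.pickleK => n _; exact: hv.
apply: negligible_bigcup => k; rewrite /F; case: choice.unpickle => [v|]; last exact: negligible_set0.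
apply/negligibleP; last exact: bad_forever_prob0.
by apply: bigcapT_measurable => n; have [] := bad_prob v n.
Qed.

Lemma not_badP v n y : ~ bad v n y -> forall e i, e \in E -> (i <= n)%N ->
  exists2 j, (j < threshold n)%N & (y (v + e *+ i) : nat -> bool) j != y (v + e *+ i + e) j.
Proof.
move=> hb e i eE iN; apply: contrapT => h; apply: hb; exists (e, i).
  by apply/allpairsP; exists (e, i); rewrite mem_iota.
move=> j jt; apply/eqP; apply: contraT => hj; exfalso; apply: h; by exists j.
Qed.

Lemma not_never_proper y e : ~ never y -> e \in E -> proper_along e (code_labels y).
Proof.
move=> hy eE v.
have key u : exists j, (y u : nat -> bool) j != y (u + e) j.
  have [n hn] : exists n, ~ bad u n y.
    apply: contrapT => h; apply: hy; exists u => n; apply: contrapT => hb.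
    by apply: h; exists n.
  have [j _] := not_badP hn eE (leq0n n); rewrite mulr0n addr0 => hj.
  by exists j.
exact: diff_code_neq.
Qed.

Lemma not_bad_stage y v n : ~ never y -> ~ bad v n y -> stage y (K * n.+1) v <> None.
Proof.
move=> hy hb; apply: assigned_by => e eE; apply: reduced_lt6; first exact: not_never_proper.
move=> i iN; have [j jt hj] := not_badP hb eE iN.
exact: diff_code_lt hj jt.
Qed.

Lemma greedy_final y : ~ never y -> exists m tau, greedy E choose m tau /\
  forall v, final y v = Some (m v).
Proof.
move=> hy; have [|v|m [tau [gm hm]]] := @greedy_assigned d A E choose (code_labels y).
- by move=> e eE; exact: not_never_proper.
- have [n hn] : exists n, ~ bad v n y.
    apply: contrapT => h; apply: hy; exists v => n; apply: contrapT => hb.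
    by apply: h; exists n.
  by exists (K * n.+1)%N; exact: not_bad_stage.
by exists m, tau; split => // v; apply: finalE (hm v).
Qed.

Hypothesis rule : forall m tau, greedy E choose m tau ->
    forall u v, norm1 (u - v) = 1%N ->
      Psi (truncate W a0 (translate u m)) <> Psi (truncate W a0 (translate v m)).

Lemma coloring_proper y : ~ never y -> forall u v, norm1 (u - v) = 1%N ->
  coloring y u <> coloring y v.
Proof.
move=> hy u v uv; have [m [tau [gm hm]]] := greedy_final hy.
have col w : coloring y w = Psi (truncate W a0 (translate w m)).
  rewrite /coloring /origin_color; case: pselect => [_|[]]; last first.
    by move=> x _; rewrite final_translate hm.
  congr Psi; apply/funext => x; rewrite /truncate; case: ifP => // _.
  by rewrite final_translate hm.
by rewrite !col; exact: rule gm _ _ uv.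
Qed.

Lemma coloring_process_coloring : coloring_process U (fun w => coloring (Y w)).
Proof.
split.
  move=> B mB; exact: (measurable_funPTI Y (coloring_measurable mB)).
have [N [mN N0 hN]] := never_negligible.
exists (Y @^-1` N); split; [exact: (measurable_funPTI Y mN)|exact: N0|].
move=> w /= h; apply: hN; apply: contrapT => hy; apply: h => u v uv.
exact: coloring_proper.
Qed.

Lemma ffiid_coloring : ffiid U (fun w => coloring (Y w)) Y coloring.
Proof.
split => //.
- exact: bit_iid.
- exact: coloring_measurable.
- exact: coloring_equivariant.
- apply: negligibleS never_negligible => y /= h; apply: contrapT => hy; apply: h.
  have [m [tau [_ hm]]] := greedy_final hy.
  have cy : complete y by move=> w _; rewrite hm.
  have [t rt] := complete_ready cy.
  by exists (radius t); exact: ready_determined.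
Qed.

(** Outside a null event, the coding radius exceeds the one reached after n rounds only if n rounds do not suffice at some site of the window. *)
Lemma coloring_tail n (r : R) : (radius (K * n.+1))%:R <= r ->
  (coding_radius_tail U Y coloring r <=
    ((size W * size E * n.+1)%:R * (2^-1) ^+ threshold n)%:E)%E.
Proof.
move=> rr; have [N [mN N0 hN]] := never_negligible.
have mb w : measurable (bad w n) by have [] := bad_prob w n.
have pb w : w \in W -> (mu (bad w n) <= ((size E * n.+1)%:R * (2^-1) ^+ threshold n)%:E)%E.
  by move=> _; have [] := bad_prob w n.
have [mB pB] := union_bound mb pb.
set B := [set y | _] in mB pB.
have mNB : measurable (N `|` B) by exact: measurableU.
apply: (@le_trans _ _ ((U^*)%mu (Y @^-1` (N `|` B)))).
  apply: le_mu_ext => w /= hr; apply: contrapT => h; move: hr.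
  have hy : ~ never (Y w) by move=> hy; apply: h; left; exact: hN.
  have rt : ready (K * n.+1) (Y w).
    by move=> v vW; apply: not_bad_stage => // hb; apply: h; right; exists v.
  apply/negP; rewrite -leNgt; apply: (@le_trans _ _ (radius (K * n.+1))%:R%:E); last first.
    by rewrite lee_fin.
  apply: ereal_inf_lbound; exists (radius (K * n.+1)) => //.
  exact: ready_determined.
rewrite measurable_mu_extE; last exact: (measurable_funPTI Y mNB).
apply: (@le_trans _ _ (mu N + mu B)%E); first exact: (measureU2 mu mN mB).
rewrite [X in (X + _)%E]N0 add0e; apply: le_trans pB _.
by rewrite lee_fin mulrA -natrM mulnA.
Qed.

(** Chosen so that floor (r / rate) = j >= 1 leaves time for j more rounds than the offset in [threshold_tail] before the radius exceeds r. *)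
Definition rate : nat := (reachW + 2 * reachE * K + reachE).+1 * ((size W * size E).+4 + 2).

Lemma radius_le n : (radius (K * n.+1) <= (reachW + 2 * reachE * K + reachE).+1 * n.+1)%N.
Proof. rewrite /radius mulnA; move: (2 * reachE * K)%N => k; nia. Qed.

Lemma coloring_tower_tail (r : R) : 0 <= r ->
  (coding_radius_tail U Y coloring r <= (1 / tower (rate%:R^-1 * r))%:E)%E.
Proof.
move=> r0; have rate0 : 0 < rate%:R :> R by rewrite ltr0n /rate muln_gt0.
have cr0 : 0 <= rate%:R^-1 * r by rewrite mulr_ge0// invr_ge0 ltW.
rewrite /tower; have /andP[jr _] := truncn_itv cr0; move: (Num.truncn _) jr => j jr.
case: j jr => [|j] jr.
  rewrite /= divr1; apply: (@le_trans _ _ ((U^*)%mu setT)); first exact: le_mu_ext.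
  by rewrite measurable_mu_extE// [leLHS]probability_setT.
pose n := ((size W * size E).+4 + j.+1)%N.
apply: le_trans (coloring_tail (n := n) _) _.
  apply: (@le_trans _ _ (rate * j.+1)%:R).
    rewrite ler_nat; apply: leq_trans (radius_le n) _.
    rewrite /rate -[X in (_ <= X)%N]mulnA; apply: leq_mul => //.
    by rewrite /n; move: (size W * size E)%N => c; nia.
  by rewrite natrM -ler_pdivlMl.
rewrite lee_fin; apply: le_trans (threshold_tail R j.+1 (erefl (size W * size E).+4)) _.
rewrite div1r lef_pV2 ?posrE ?ltr0n; first exact: iter_expR_le_tower4.
  exact: leq_ltn_trans (tower4_gt _).
by elim: (j.+1) => //= k _; exact: expR_gt0.
Qed.

End construction.

Lemma ffiid_coloring_exists (R : realType) (d q : nat) : local_rule d q ->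
  exists2 c : R, 0 < c &
    exists (dO : measure_display) (Omega : measurableType dO)
            (P : probability Omega R) (X : Omega -> config d 'I_q)
            (dS : measure_display) (S : measurableType dS)
            (Y : {RV P >-> labelings d S})
            (F : labelings d S -> config d 'I_q),
       [/\ coloring_process P X,
           ffiid P X Y F &
           forall r : R, 0 <= r ->
             (coding_radius_tail P Y F r <= (1 / tower (c * r))%:E)%E].
Proof.
move=> [A [E [W [choose [Psi [E0 rule]]]]]].
exists (rate E W)%:R^-1; first by rewrite invr_gt0 ltr0n /rate muln_gt0.
exists _, (measurableTypeR R), (uniform_prob (@ltr01 R)),
  (fun w => coloring E W choose Psi (bit_RV R d w)), _, bitseq, (bit_RV R d),
  (coloring E W choose Psi).
split.
- exact: coloring_process_coloring.
- exact: ffiid_coloring.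
- move=> r r0; exact: coloring_tower_tail.
Qed.

Theorem theorem1 (R : realType) (d q : nat)
    (hdq : (d = 1 /\ 3 <= q)%N \/ (2 <= d /\ 4 <= q)%N) :
  exists c C : R, [/\ 0 < c, 0 < C,
    (exists (dO : measure_display) (Omega : measurableType dO)
            (P : probability Omega R) (X : Omega -> config d 'I_q)
            (dS : measure_display) (S : measurableType dS)
            (Y : {RV P >-> labelings d S})
            (F : labelings d S -> config d 'I_q),
       [/\ coloring_process P X,
           ffiid P X Y F &
           forall r : R, 0 <= r ->
             (coding_radius_tail P Y F r <= (1 / tower (c * r))%:E)%E]) &
    (forall (dO : measure_display) (Omega : measurableType dO)
            (P : probability Omega R) (X : Omega -> config d 'I_q)
            (dS : measure_display) (S : measurableType dS)
            (Y : {RV P >-> labelings d S})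
            (F : labelings d S -> config d 'I_q),
       coloring_process P X ->
       ffiid P X Y F ->
       forall r : R, 0 <= r ->
         ((1 / tower (C * r))%:E <= coding_radius_tail P Y F r)%E)].
Proof.
have d0 : (0 < d)%N by case: hdq => -[] => [->|/ltnW].
have [c c0 upper] := ffiid_coloring_exists R (local_rule_exists hdq).
exists c, (3 * q + 11)%:R; split => //.
move=> dO Omega P X dS S Y F colX facX r r0.
exact: (coding_radius_tail_ge colX facX (Ordinal d0)).
Qed.
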